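(* Let $\Sigma=\{c_1,\dots,c_\sigma\}$ be a finite alphabet, let $s\in\Sigma^n$ be a primitive string, and for every string $x$ over $\Sigma$ let $\pi_x$ be a total order of $\Sigma$. Suppose we are given $L=BWT_{*}(s)$ with constant-time rank support, the orderings $\pi_x$, and the index $i$ of the row of $M_{*}(s)$ equal to $s$. Then $s$ can be recovered in ${\cal O}(\sigma |s|^2)$ time and ${\cal O}(\sigma |s|)$ working space.
   Context: A string is primitive if all its $n$ cyclic rotations are distinct. The context adaptive BWT matrix $M_{*}(s)$ is the $n\times n$ matrix whose rows (numbered $1,\dots,n$ from top to bottom) are the cyclic rotations of $s$, sorted as follows: for two distinct rotations $u\neq v$, let $x$ be their longest common prefix ($|x|<n$) and let $a\neq b$ be the symbols following $x$ in $u$ and $v$ respectively; then $u$ precedes $v$ iff $a$ precedes $b$ in the order $\pi_x$. $BWT_{*}(s)$ is the last column $L$ of $M_{*}(s)$, read top to bottom. For $c\in\Sigma$, $\mathsf{rank}_c(L,j)$ is the number of occurrences of $c$ in $L[1,j]$; ''constant-time rank support'' means these queries are answered in ${\cal O}(1)$ time. Computational model: word RAM with word size $w$ and $\sigma=w^{{\cal O}(1)}$. *)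

(* Defs.v *)
From mathcomp Require Import all_boot.

Set Implicit Arguments.
Unset Strict Implicit.
Unset Printing Implicit Defensive.

Section ContextAdaptiveBWT.

Variable sigma : nat.

(* The alphabet {c_1, ..., c_sigma} is 'I_sigma; positions, rows and symbols
   are numbered from 0. *)
Notation symbol := 'I_sigma.
Notation string := (seq symbol).

Definition is_total_order (r : rel symbol) : Prop :=
  [/\ reflexive r, antisymmetric r, transitive r & total r].

Definition rotations (s : string) : seq string :=
  [seq rot k s | k <- iota 0 (size s)].

Definition primitive (s : string) : bool := uniq (rotations s).

Fixpoint lcp (u v : string) : string :=
  match u, v with
  | a :: u', b :: v' => if a == b then a :: lcp u' v' else [::]
  | _, _ => [::]
  end.

(* [pi x a b] reads "a = b or a precedes b in the order pi_x". *)
Definition precedes (pi : string -> rel symbol) (u v : string) : bool :=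
  let x := lcp u v in
  match onth u (size x), onth v (size x) with
  | Some a, Some b => pi x a b
  | _, _ => false
  end.

Definition ca_matrix (pi : string -> rel symbol) (s : string) : seq string :=
  sort (fun u v => (u == v) || precedes pi u v) (rotations s).

Definition last_column (M : seq string) : string :=
  pmap (fun row : string => onth row (size row).-1) M.

Definition ca_bwt (pi : string -> rel symbol) (s : string) : string :=
  last_column (ca_matrix pi s).

(* Occurrences of the symbol number c among the first j symbols of L. *)
Definition rank (L : string) (c j : nat) : nat :=
  count (fun a : symbol => val a == c) (take j L).

(* The symbols listed in increasing order for r. *)
Definition listing (r : rel symbol) : string := sort r (enum symbol).

End ContextAdaptiveBWT.

(* Word RAM. A program is a finite list of instructions acting on registers
   (finitely many occur in a program) and on a working memory addressed by
   words; words are the natural numbers below 2 ^ w. *)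

Inductive binop : Type :=
  | OAdd | OSub | OMul | ODiv | OMod | OAnd | OOr | OXor | OShl | OShr.

Definition eval_binop (w : nat) (o : binop) (a b : nat) : nat :=
  match o with
  | OAdd => (a + b) %% 2 ^ w
  | OSub => (a + (2 ^ w - b)) %% 2 ^ w
  | OMul => (a * b) %% 2 ^ w
  | ODiv => a %/ b
  | OMod => a %% b
  | OAnd => Nat.land a b
  | OOr => Nat.lor a b
  | OXor => Nat.lxor a b
  | OShl => (a * 2 ^ b) %% 2 ^ w
  | OShr => a %/ 2 ^ b
  end.

(* Operands are register numbers, except the immediate v of IConst and the
   jump targets, which are absolute positions in the program. The last three
   instructions are the only access to the input string L and to the
   orderings:
     ILast  d j      d := L[j]
     IRank  d c j    d := rank_c(L, j)
     IOrder d a l k  d := k-th symbol in the order pi_x, where x is the string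
                     of length l stored in memory from address a on. *)
Inductive instr : Type :=
  | IConst (d v : nat)
  | IOp (o : binop) (d a b : nat)
  | ILoad (d a : nat)
  | IStore (a b : nat)
  | IJump (t : nat)
  | IJumpLt (a b t : nat)
  | IJumpEq (a b t : nat)
  | ILast (d j : nat)
  | IRank (d c j : nat)
  | IOrder (d a l k : nat)
  | IHalt.

Definition program : Type := seq instr.

(* [time] is the cost of the run so far; [space] is one more than the largest
   memory address accessed so far (0 if there is none). *)
Record config : Type := Config {
  pc : nat;
  regs : nat -> nat;
  memory : nat -> nat;
  time : nat;
  space : nat }.

Definition update (f : nat -> nat) (a v : nat) : nat -> nat :=
  fun b => if b == a then v else f b.

Section Semantics.

Variables (w sigma : nat).
Variables (L : seq 'I_sigma) (pi : seq 'I_sigma -> rel 'I_sigma).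

Definition read_string (m : nat -> nat) (a l : nat) : option (seq 'I_sigma) :=
  let cells := [seq m t | t <- iota a l] in
  if all (fun v => v < sigma) cells then Some (pmap insub cells) else None.

Definition set_reg (c : config) (d v : nat) : config :=
  Config (pc c).+1 (update (regs c) d v) (memory c) (time c).+1 (space c).

Definition goto (c : config) (t : nat) : config :=
  Config t (regs c) (memory c) (time c).+1 (space c).

(* None: the program counter is out of range, the machine has halted, or an
   input query is ill-formed. Every instruction costs 1, except that querying
   pi_x costs |x| + 1. *)
Definition step (P : program) (c : config) : option config :=
  let R := regs c in
  match onth P (pc c) with
  | None | Some IHalt => None
  | Some (IConst d v) => Some (set_reg c d (v %% 2 ^ w))
  | Some (IOp o d a b) => Some (set_reg c d (eval_binop w o (R a) (R b)))
  | Some (ILoad d a) =>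
      Some (Config (pc c).+1 (update R d (memory c (R a))) (memory c)
                   (time c).+1 (maxn (space c) (R a).+1))
  | Some (IStore a b) =>
      Some (Config (pc c).+1 R (update (memory c) (R a) (R b))
                   (time c).+1 (maxn (space c) (R a).+1))
  | Some (IJump t) => Some (goto c t)
  | Some (IJumpLt a b t) => Some (goto c (if R a < R b then t else (pc c).+1))
  | Some (IJumpEq a b t) => Some (goto c (if R a == R b then t else (pc c).+1))
  | Some (ILast d j) => omap (fun a => set_reg c d (val a)) (onth L (R j))
  | Some (IRank d x j) =>
      if (R x < sigma) && (R j <= size L)
      then Some (set_reg c d (rank L (R x) (R j))) else None
  | Some (IOrder d a l k) =>
      if R a + R l <= 2 ^ w then
        obind (fun x =>
          omap (fun b => Config (pc c).+1 (update R d (val b)) (memory c)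
                                (time c + (R l).+1)
                                (maxn (space c) (R a + R l)))
               (onth (listing (pi x)) (R k)))
          (read_string (memory c) (R a) (R l))
      else None
  end.

Definition halted (P : program) (c : config) : Prop :=
  onth P (pc c) = Some IHalt.

(* Registers 0, 1, 2 hold the length of L, the alphabet size and the row
   index; all other registers and the working memory are zero. *)
Definition init (i : nat) : config :=
  Config 0 (nth 0 [:: size L; sigma; i]) (fun=> 0) 0 0.

Definition halts_with (P : program) (i : nat) (c : config) : Prop :=
  (exists t, iter t (obind (step P)) (Some (init i)) = Some c) /\ halted P c.

End Semantics.

(* Main.v *)
From HB Require Import structures.
Require Import Defs.
From mathcomp Require Import all_boot.
From mathcomp Require Import zify.

(* The rows of the matrix M are sorted column by column. At level m there is a
   permutation phi of the rows such that row phi(q), rotated so that its last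
   symbol comes first, agrees with row q on the first m symbols; at level 0 phi
   is the identity. The rows sharing their first m symbols y form a contiguous
   block, and both the block and its rotated phi-image list the rotations of s
   that begin with y. Column m of the block is sorted by pi_y, so sorting the
   phi-image by its column m in the order pi_y makes phi agree on m + 1
   symbols. Iterating phi from row q and reading L spells out the first m
   symbols of row q: this yields the context y passed to the order oracle, and
   at level n, from row i, the string s.

   Querying pi_y costs |y| + 1 per symbol, so it is done only for the blocks
   that do split. There are fewer than n splits over all the levels, hence the
   queries cost O(sigma n^2) in total, and the rest costs O(sigma n) per
   level. *)

Set Implicit Arguments.
Unset Strict Implicit.
Unset Printing Implicit Defensive.

(** * Sequences *)

Lemma filter_iota_interval (p : pred nat) lo hi n : lo <= hi <= n ->
  (forall j, j < n -> p j = (lo <= j < hi)) ->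
  [seq j <- iota 0 n | p j] = iota lo (hi - lo).
Proof.
case/andP=> lohi hin pE; apply: (irr_sorted_eq ltn_trans ltnn).
- exact/(sorted_filter ltn_trans)/iota_ltn_sorted.
- exact: iota_ltn_sorted.
move=> j; rewrite mem_filter !mem_iota subnKC // add0n /=.
by case: (ltnP j n) => [/pE->|]; [rewrite andbT | lia].
Qed.

Section Letters.

Variable sigma : nat.
Implicit Types u v : seq 'I_sigma.

Definition letter u t : nat := nth 0 (map val u) t.

Lemma letter_val x0 u t : t < size u -> letter u t = val (nth x0 u t).
Proof. exact: nth_map. Qed.

Lemma letter_lt u t : t < size u -> letter u t < sigma.
Proof. by case: u => // a u ltt; rewrite (letter_val a) ?ltn_ord. Qed.

Lemma onth_letter u t : t < size u ->
  exists2 a, onth u t = Some a & letter u t = val a.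
Proof.
case: u => // b u ltt; exists (nth b (b :: u) t); last exact: letter_val.
by rewrite onthE (nth_map b).
Qed.

Lemma letter_take u m t : t < m -> letter (take m u) t = letter u t.
Proof. by move=> ltt; rewrite /letter map_take nth_take. Qed.

Lemma letter_rotr1S u t : t.+1 < size u -> letter (rotr 1 u) t.+1 = letter u t.
Proof.
case/lastP: u => // u a; rewrite size_rcons ltnS => ltt.
by rewrite /letter rotr1_rcons map_rcons nth_rcons size_map ltt.
Qed.

Lemma eq_take_letterS u v m :
  size u = size v -> m < size u ->
  (take m.+1 u == take m.+1 v) =
  (take m u == take m v) && (letter u m == letter v m).
Proof.
case: u => [|a u] // size_uv ltm.
by rewrite !(take_nth a) -?size_uv // eqseq_rcons !(letter_val a) -?size_uv.
Qed.

End Letters.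

Section Buckets.

Variables (T K : eqType) (key : T -> K).

Definition buckets (l : seq K) (s : seq T) : seq T :=
  flatten [seq [seq x <- s | key x == a] | a <- l].

Lemma buckets_cat l1 l2 s : buckets (l1 ++ l2) s = buckets l1 s ++ buckets l2 s.
Proof. by rewrite /buckets map_cat flatten_cat. Qed.

Lemma buckets_rcons l a s :
  buckets (rcons l a) s = buckets l s ++ [seq x <- s | key x == a].
Proof. by rewrite -cats1 buckets_cat /buckets /= cats0. Qed.

Lemma size_buckets_take k l s :
  size (buckets (take k l) s) <= size (buckets l s).
Proof. by rewrite -{2}(cat_take_drop k l) buckets_cat size_cat leq_addr. Qed.

Lemma perm_buckets l s :
  uniq l -> {in s, forall x, key x \in l} -> perm_eq (buckets l s) s.
Proof.
elim: l s => [|a l IH] s /=.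
  by case: s => // x s _ /(_ x (mem_head _ _)).
case/andP=> a_l uniq_l key_s; rewrite /buckets /=.
rewrite perm_sym -(perm_filterC (fun x => key x == a) s) perm_cat2l perm_sym.
rewrite -/(buckets l s).
suff -> : buckets l s = buckets l [seq x <- s | key x != a].
  apply: IH => // x; rewrite mem_filter => /andP[neq_xa /key_s].
  by rewrite inE (negPf neq_xa).
congr flatten; apply/eq_in_map => b b_l; rewrite -filter_predI.
apply: eq_filter => x /=; case: eqP => // ->.
by case: eqP => // eq_ba; rewrite -eq_ba b_l in a_l.
Qed.

Lemma sorted_buckets (r : rel K) l s :
  reflexive r -> transitive r -> sorted r l -> sorted r (map key (buckets l s)).
Proof.
move=> refl trans; rewrite !sorted_pairwise //.
have key_bucket a x : x \in map key [seq y <- s | key y == a] -> x = a.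
  by case/mapP => y; rewrite mem_filter => /andP[/eqP <- _].
elim: l => //= a l IH /andP[le_al sorted_l].
rewrite /buckets /= map_cat pairwise_cat IH // andbT; apply/andP; split.
  apply/allrelP => x y /key_bucket -> /mapP[z /flattenP[_ /mapP[b b_l ->]]].
  by rewrite mem_filter => /andP[/eqP -> _] ->; apply: (allP le_al).
apply/(pairwiseP a) => i j; rewrite !inE => lti ltj _.
by rewrite !(key_bucket a _ (mem_nth _ _)).
Qed.

End Buckets.

(** * The context adaptive order *)

Section AdaptiveOrder.

Variable sigma : nat.
Implicit Types (pi : seq 'I_sigma -> rel 'I_sigma) (u v w : seq 'I_sigma).

Definition ca_le pi u v := (u == v) || precedes pi u v.

Lemma ca_le_cons pi a b u v :
  ca_le pi (a :: u) (b :: v) =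
  if a == b then ca_le (fun x => pi (a :: x)) u v else pi [::] a b.
Proof.
rewrite /ca_le /precedes /= eqseq_cons.
by case: eqP => //= ->.
Qed.

Lemma ca_le_total pi u v :
  (forall x, is_total_order (pi x)) -> size u = size v ->
  ca_le pi u v || ca_le pi v u.
Proof.
elim: u v pi => [|a u IH] [|b v] pi //= tot_pi [size_uv].
rewrite !ca_le_cons eq_sym; case: eqP => [->|_].
  by apply: IH => // x; apply: tot_pi.
by case: (tot_pi [::]) => _ _ _; apply.
Qed.

Lemma ca_le_trans pi v u w :
  (forall x, is_total_order (pi x)) -> size u = size v -> size v = size w ->
  ca_le pi u v -> ca_le pi v w -> ca_le pi u w.
Proof.
elim: v u w pi => [|b v IH] [|a u] [|c w] pi //= tot_pi [size_uv] [size_vw].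
rewrite !ca_le_cons; case: (tot_pi [::]) => _ anti trans _.
case: (eqVneq a b) => [<-|neq_ab].
  by case: eqP => // _; apply: IH => // x; apply: tot_pi.
case: (eqVneq b c) => [<-|neq_bc] le_ab; first by rewrite (negPf neq_ab).
move=> le_bc; case: eqP => [eq_ac|_]; last exact: trans le_ab le_bc.
by case/eqP: neq_ab; apply: anti; rewrite le_ab eq_ac le_bc.
Qed.

Lemma ca_le_take_convex pi m u v w :
  (forall x, is_total_order (pi x)) -> size u = size v -> size v = size w ->
  ca_le pi u v -> ca_le pi v w -> take m u = take m w -> take m u = take m v.
Proof.
elim: m u v w pi => [|m IH] u v w pi; first by rewrite !take0.
case: u v w => [|a u] [|b v] [|c w] //= tot_pi [size_uv] [size_vw].
rewrite !ca_le_cons => le_uv le_vw [eq_ac eq_uw]; subst c.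
case: (tot_pi [::]) => _ anti _ _.
move: le_uv le_vw; case: (eqVneq a b) => [<-|neq_ab].
  move=> le_uv le_vw; congr (_ :: _).
  by apply: IH le_uv le_vw eq_uw => // x; apply: tot_pi.
by move=> le_ab le_ba; case/eqP: neq_ab; apply: anti; rewrite le_ab le_ba.
Qed.

Lemma ca_le_nth pi x0 m u v :
  (forall x, is_total_order (pi x)) -> size u = size v -> m < size u ->
  ca_le pi u v -> take m u = take m v ->
  pi (take m u) (nth x0 u m) (nth x0 v m).
Proof.
elim: m u v pi => [|m IH] [|a u] [|b v] pi //= tot_pi [size_uv] ltm.
  rewrite ca_le_cons; case: eqP => [->|//].
  by case: (tot_pi [::]) => refl _ _ _ *; apply: refl.
rewrite ca_le_cons => + [eq_ab eq_uv]; subst b; rewrite eqxx => le_uv.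
by apply: (IH u v (fun x => pi (a :: x))) => // x; apply: tot_pi.
Qed.

Lemma perm_rotations_rotr (s : seq 'I_sigma) :
  perm_eq [seq rotr 1 u | u <- rotations s] (rotations s).
Proof.
rewrite /rotations -map_comp; case def_n: (size s) => [//|n].
have rotr_rot0 : rotr 1 (rot 0 s) = rot n s by rewrite rot0 /rotr def_n subn1.
have rotr_rotS k : k < n -> rotr 1 (rot k.+1 s) = rot k s.
  by move=> ltk; rewrite -(add1n k) rotD; [apply: rotK | lia].
rewrite (_ : map _ _ = rot n s :: [seq rot k s | k <- iota 0 n]).
  by rewrite -addn1 iotaD map_cat -cat1s perm_catC add0n.
rewrite /= rotr_rot0 -[1]addn0 iotaDl -map_comp; congr (_ :: _).
by apply/eq_in_map => k; rewrite mem_iota => ltk /=; rewrite add1n rotr_rotS.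
Qed.

Lemma last_columnE x0 (M : seq (seq 'I_sigma)) :
  all (fun u => 0 < size u) M -> last_column M = [seq last x0 u | u <- M].
Proof.
rewrite /last_column; elim: M => //= u M IH /andP[u_gt0 /IH->].
by rewrite onthE (nth_map x0) ?nth_last // prednK.
Qed.

End AdaptiveOrder.

(** * Blocks of the matrix *)

Section Matrix.

Variables (sigma n : nat) (s : n.-tuple 'I_sigma).
Variable pi : seq 'I_sigma -> rel 'I_sigma.

Local Notation M := (ca_matrix pi s).

Lemma alphabet_gt0 : 0 < n -> 0 < sigma.
Proof.
by move=> n_gt0; apply: leq_ltn_trans (ltn_ord (tnth s (Ordinal n_gt0))).
Qed.

Lemma perm_ca_matrix : perm_eq M (rotations s).
Proof. by rewrite perm_sort. Qed.

Lemma size_ca_matrix : size M = n.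
Proof. by rewrite (perm_size perm_ca_matrix) size_map size_iota size_tuple. Qed.

Lemma size_ca_matrix_row u : u \in M -> size u = n.
Proof.
rewrite (perm_mem perm_ca_matrix) => /mapP[j _ ->].
by rewrite size_rot size_tuple.
Qed.

Definition row q := nth [::] M q.

Lemma size_row q : q < n -> size (row q) = n.
Proof.
by move=> ltq; rewrite size_ca_matrix_row // mem_nth // size_ca_matrix.
Qed.

Lemma ca_matrixE : M = [seq row q | q <- iota 0 n].
Proof.
rewrite -[RHS]/(map (nth [::] M) _) map_nth_iota0 ?size_ca_matrix //.
by rewrite take_oversize ?size_ca_matrix.
Qed.

Definition entry q t := letter (row q) t.
Definition rot_entry q t := letter (rotr 1 (row q)) t.

Lemma entry_lt q t : q < n -> t < n -> entry q t < sigma.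
Proof. by move=> ltq ltt; rewrite letter_lt ?size_row. Qed.

Lemma rot_entryS q t : q < n -> t.+1 < n -> rot_entry q t.+1 = entry q t.
Proof. by move=> ltq ltt; rewrite /rot_entry letter_rotr1S ?size_row. Qed.

Lemma ca_matrix_row_gt0 u : u \in M -> 0 < size u.
Proof.
move=> u_M; rewrite (size_ca_matrix_row u_M) -size_ca_matrix.
by case: M u_M.
Qed.

Lemma size_ca_bwt : size (ca_bwt pi s) = n.
Proof.
rewrite size_pmap -[RHS]size_ca_matrix; apply/eqP; rewrite -all_count.
by apply/allP => -[|a u] /ca_matrix_row_gt0 //= _; rewrite onthE (nth_map a).
Qed.

Lemma letter_ca_bwt q : q < n -> letter (ca_bwt pi s) q = rot_entry q 0.
Proof.
move=> ltq; have x0 : 'I_sigma := tnth s (Ordinal ltq).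
rewrite /ca_bwt (last_columnE x0); last exact/allP/ca_matrix_row_gt0.
rewrite (letter_val x0) ?size_map ?(nth_map [::]) ?size_ca_matrix // -/(row q).
have: 0 < size (row q) by rewrite size_row // (leq_ltn_trans _ ltq).
rewrite /rot_entry; case/lastP: (row q) => // u a _.
by rewrite last_rcons rotr1_rcons.
Qed.

Definition prefix_eq m p q := take m (row p) == take m (row q).

Lemma prefix_eqS m p q : m < n -> p < n -> q < n ->
  prefix_eq m.+1 p q = prefix_eq m p q && (entry p m == entry q m).
Proof. by move=> ltm ltp ltq; apply: eq_take_letterS; rewrite !size_row. Qed.

Lemma prefix_eq_entry m p q t :
  prefix_eq m p q -> t < m -> entry p t = entry q t.
Proof.
by move=> /eqP eq_pq ltt; rewrite /entry -(letter_take _ ltt) eq_pq letter_take.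
Qed.

(* [opens m j]: row j is the first of a block of rows sharing their first m
   symbols; row n counts as the opening of a block past the end. *)
Definition opens m j := [|| j == 0, j == n | ~~ prefix_eq m j.-1 j].

Lemma opens0 j : opens 0 j = (j == 0) || (j == n).
Proof. by rewrite /opens /prefix_eq !take0 eqxx orbF. Qed.

Lemma opens_end m : opens m n.
Proof. by rewrite /opens eqxx orbT. Qed.

Lemma opensS m j : m < n -> 0 < j < n ->
  opens m.+1 j = opens m j || (entry j.-1 m != entry j m).
Proof. by move=> ltm inj; rewrite /opens prefix_eqS //; lia. Qed.

Lemma opens_mono m j : m < n -> j <= n -> opens m j -> opens m.+1 j.
Proof.
move=> ltm lej; case: (posnP j) => [-> //|j_gt0].
case: (eqVneq j n) => [->|ne_j]; first by rewrite /opens eqxx orbT.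
by rewrite opensS //; [move=> -> | lia].
Qed.

Definition is_block m lo hi :=
  [/\ lo < hi <= n, opens m lo, opens m hi
    & forall j, lo < j < hi -> ~~ opens m j].

Lemma block_prefix_eq m lo hi j :
  is_block m lo hi -> lo <= j < hi -> prefix_eq m lo j.
Proof.
case=> _ _ _ closed; elim: j => [|j IH].
  by rewrite leqn0 => /andP[/eqP-> _]; apply: eqxx.
case/andP; rewrite leq_eqVlt => /orP[/eqP-> _|lt_lo lt_hi]; first exact: eqxx.
have /IH /eqP eq_lo : lo <= j < hi by lia.
have /closed : lo < j.+1 < hi by lia.
rewrite /opens !negb_or negbK => /and3P[_ _ /eqP eq_j].
by rewrite /prefix_eq eq_lo eq_j.
Qed.

Definition opened m x := count (opens m) (iota 0 x).

Definition splits m x :=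
  count (fun j => ~~ opens m j && opens m.+1 j) (iota 0 x).

Lemma opened_le m x : opened m x <= x.
Proof. by rewrite (leq_trans (count_size _ _)) ?size_iota. Qed.

Lemma openedS m : m < n -> opened m.+1 n = opened m n + splits m n.
Proof.
move=> ltm; rewrite /opened /splits -count_predUI.
rewrite (_ : count (predI _ _) _ = 0) ?addn0; last first.
  by apply/eqP; rewrite eqn0Ngt -has_count; apply/hasPn => j _ /=; case: opens.
apply: eq_in_count => j; rewrite mem_iota => ltj /=.
by case op: (opens m j) => //=; apply: opens_mono op => //; lia.
Qed.

Lemma splits_leq m lo hi : lo <= hi -> splits m lo <= splits m hi.
Proof. by move=> le; rewrite /splits -(subnKC le) iotaD count_cat leq_addr. Qed.

Lemma ltn_splits m lo hi j :
  lo <= j < hi -> ~~ opens m j -> opens m.+1 j -> splits m lo < splits m hi.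
Proof.
move=> inj closed op; have splitsS : splits m j.+1 = (splits m j).+1.
  by rewrite /splits -(addn1 j) iotaD count_cat /= closed op addn0 addn1.
have := @splits_leq m lo j; have := @splits_leq m j.+1 hi; lia.
Qed.

Hypothesis tot_pi : forall x, is_total_order (pi x).

Lemma row_le p q : p < q < n -> ca_le pi (row p) (row q).
Proof.
case/andP => ltpq ltq.
have sizeM : all (fun u => size u == n) M.
  by apply/allP => u /size_ca_matrix_row ->.
have trans_M : {in fun u : seq _ => size u == n & &, transitive (ca_le pi)}.
  by move=> v u w /eqP sv /eqP su /eqP sw; apply: ca_le_trans; rewrite ?su ?sv.
have: pairwise (ca_le pi) M.
  rewrite -(sorted_pairwise_in trans_M) //.
  apply: (@sort_sorted_in _ (fun u => size u == n)).
    by move=> u v /eqP su /eqP sv; apply: ca_le_total; rewrite ?su.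
  by apply/allP => u; rewrite -(perm_mem perm_ca_matrix) => /(allP sizeM).
move/(pairwiseP [::]); apply; rewrite ?inE ?size_ca_matrix //.
exact: ltn_trans ltpq ltq.
Qed.

Lemma prefix_eq_convex m p q r :
  p <= q <= r -> r < n -> prefix_eq m p r -> prefix_eq m p q.
Proof.
case/andP => lepq leqr ltr eq_pr.
case: (ltngtP p q) lepq => // [ltpq|<-] _; last exact/eqP.
case: (ltngtP q r) leqr => // [ltqr|->//] _.
have ltq := ltn_trans ltqr ltr; have ltp := ltn_trans ltpq ltq.
apply/eqP; apply: (@ca_le_take_convex _ pi m _ _ (row r)); rewrite ?size_row //.
- by apply: row_le; rewrite ltpq.
- by apply: row_le; rewrite ltqr.
- exact/eqP.
Qed.

Lemma opens_separates m p j q :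
  opens m j -> p < j <= q -> q < n -> ~~ prefix_eq m p q.
Proof.
move=> op inj ltq; apply/negP => eq_pq; move: op; rewrite /opens.
have eq_below r : p <= r <= q -> take m (row p) = take m (row r).
  by move=> inr; apply/eqP/(prefix_eq_convex inr).
do 2![case: eqP => [|_ /=]; first by lia].
by rewrite /prefix_eq -!eq_below ?eqxx //; lia.
Qed.

Lemma prefix_eq_block m lo hi j :
  is_block m lo hi -> j < n -> prefix_eq m lo j = (lo <= j < hi).
Proof.
move=> blk ltj; apply/idP/idP => [eq_j|]; last exact: block_prefix_eq.
have [lohi op_lo op_hi _] := blk.
case: (ltnP j lo) => [ltlo|_] /=.
  have : ~~ prefix_eq m j lo by apply: opens_separates op_lo _ _; lia.
  by rewrite /prefix_eq eq_sym -/(prefix_eq m lo j) eq_j.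
rewrite ltnNge; apply: contraL eq_j => gehi.
by apply: opens_separates op_hi _ _; lia.
Qed.

(** * Refining a block *)

Definition permutes (f : nat -> nat) :=
  perm_eq [seq f q | q <- iota 0 n] (iota 0 n).

Definition tracks (f : nat -> nat) m q :=
  take m (rotr 1 (row (f q))) = take m (row q).

Lemma permutes_lt f q : permutes f -> q < n -> f q < n.
Proof.
move=> /perm_mem/(_ (f q)) + ltq.
by rewrite mem_iota leq0n andTb add0n => <-; rewrite map_f ?mem_iota.
Qed.

Lemma tracks_entry f m q t :
  tracks f m q -> t < m -> rot_entry (f q) t = entry q t.
Proof.
move=> tracks_q ltt.
by rewrite /rot_entry /entry -(letter_take _ ltt) tracks_q letter_take.
Qed.

Lemma tracksS f m q : permutes f -> q < n -> m < n ->
  tracks f m q -> rot_entry (f q) m = entry q m -> tracks f m.+1 q.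
Proof.
move=> perm_f ltq ltm tracks_q eq_m; apply/eqP.
rewrite eq_take_letterS; first last.
- by rewrite size_rotr size_row ?permutes_lt.
- by rewrite size_rotr !size_row ?permutes_lt.
by rewrite tracks_q eqxx; apply/eqP.
Qed.

Lemma perm_rotated_rows f : permutes f ->
  perm_eq [seq rotr 1 (row (f q)) | q <- iota 0 n] [seq row q | q <- iota 0 n].
Proof.
move=> perm_f; rewrite (map_comp (fun q => rotr 1 (row q)) f).
apply: perm_trans (perm_map _ perm_f) _.
rewrite (map_comp (rotr 1) row) -ca_matrixE.
apply: perm_trans (perm_map _ perm_ca_matrix) _.
by apply: perm_trans (perm_rotations_rotr s) _; rewrite perm_sym perm_ca_matrix.
Qed.

Section Refinement.

Variables (f : nat -> nat) (m lo hi : nat).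
Hypothesis perm_f : permutes f.
Hypothesis tracks_f : forall q, q < n -> tracks f m q.
Hypothesis ltm : m < n.
Hypothesis blk : is_block m lo hi.

Let lohi : lo < hi <= n. Proof. by case: blk. Qed.

Let block_rows := iota lo (hi - lo).

Let mem_block q : (q \in block_rows) = (lo <= q < hi).
Proof. by rewrite mem_iota subnKC //; lia. Qed.

(* Both sides list the rotations that begin with the prefix of the block. *)
Lemma perm_rotated_block :
  perm_eq [seq rotr 1 (row (f q)) | q <- block_rows]
          [seq row q | q <- block_rows].
Proof.
have filter_block :
    [seq q <- iota 0 n | take m (row lo) == take m (row q)] = block_rows.
  apply: filter_iota_interval => [|j ltj]; first by lia.
  exact: prefix_eq_block.
have := perm_rotated_rows perm_f.
move/(perm_filter (fun u => take m (row lo) == take m u)).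
rewrite !filter_map /= filter_block.
rewrite (_ : filter _ (iota 0 n) = block_rows) // -filter_block.
by apply: eq_in_filter => q; rewrite mem_iota => ltq /=; rewrite tracks_f.
Qed.

Lemma perm_block_keys :
  perm_eq [seq rot_entry (f q) m | q <- block_rows]
          [seq entry q m | q <- block_rows].
Proof.
have := perm_map (fun u => letter u m) perm_rotated_block.
by rewrite -!map_comp.
Qed.

Let image := [seq f q | q <- block_rows].

Definition sorted_image :=
  buckets (rot_entry^~ m) (map val (listing (pi (take m (row lo))))) image.

Lemma sorted_imageE x0 :
  sorted_image = buckets (fun q => nth x0 (rotr 1 (row q)) m)
                         (listing (pi (take m (row lo)))) image.
Proof.
rewrite /sorted_image /buckets -map_comp; congr flatten; apply/eq_map => a /=.
apply/eq_in_filter => _ /mapP[q + ->]; rewrite mem_block => inq.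
rewrite /rot_entry (letter_val x0) // size_rotr size_row // permutes_lt //.
by lia.
Qed.

Lemma perm_sorted_image : perm_eq sorted_image image.
Proof.
have x0 : 'I_sigma := tnth s (Ordinal ltm).
rewrite (sorted_imageE x0) perm_buckets ?sort_uniq ?enum_uniq // => q _.
by rewrite mem_sort mem_enum.
Qed.

Lemma size_sorted_image : size sorted_image = hi - lo.
Proof. by rewrite (perm_size perm_sorted_image) size_map size_iota. Qed.

Lemma sorted_block_entries x0 :
  sorted (pi (take m (row lo))) [seq nth x0 (row q) m | q <- block_rows].
Proof.
have [_ _ trans _] := tot_pi (take m (row lo)).
rewrite sorted_pairwise //; apply/(pairwiseP x0) => p q.
rewrite !inE size_map size_iota => ltp ltq ltpq.
rewrite !(nth_map 0) ?size_iota // !nth_iota //.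
have eq_lo r : r < hi - lo -> take m (row lo) = take m (row (lo + r)).
  by move=> ltr; apply/eqP/(block_prefix_eq blk); lia.
rewrite (eq_lo p) //; apply: ca_le_nth; rewrite ?size_row //; try lia.
  by apply: row_le; lia.
by rewrite -!eq_lo.
Qed.

Lemma sorted_image_keys :
  [seq rot_entry p m | p <- sorted_image] = [seq entry q m | q <- block_rows].
Proof.
have x0 : 'I_sigma := tnth s (Ordinal ltm).
have [refl anti trans tot] := tot_pi (take m (row lo)).
have eq_symbols : [seq nth x0 (rotr 1 (row p)) m | p <- sorted_image]
                  = [seq nth x0 (row q) m | q <- block_rows].
  apply: (sorted_eq trans anti); last first.
  - apply: perm_trans (perm_map _ perm_sorted_image) _.
    have := perm_map (fun u => nth x0 u m) perm_rotated_block.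
    by rewrite -!map_comp.
  - exact: sorted_block_entries.
  rewrite (sorted_imageE x0); apply: sorted_buckets => //.
  exact: sort_sorted.
have := congr1 (map val) eq_symbols; rewrite -!map_comp => eq_val.
transitivity [seq val (nth x0 (rotr 1 (row p)) m) | p <- sorted_image].
  apply/eq_in_map => p; rewrite (perm_mem perm_sorted_image) => /mapP[q].
  rewrite mem_block => inq ->; apply: letter_val.
  by rewrite size_rotr size_row ?permutes_lt //; lia.
rewrite [LHS]eq_val; apply/eq_in_map => q; rewrite mem_block => inq /=.
by rewrite /entry (letter_val x0) // size_row //; lia.
Qed.

Definition sort_block q :=
  if lo <= q < hi then nth 0 sorted_image (q - lo) else f q.

Lemma permutes_sort_block : permutes sort_block.
Proof.
apply: perm_trans perm_f.
have -> : n = lo + ((hi - lo) + (n - hi)) by lia.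
rewrite !iotaD add0n !map_cat -/block_rows.
have -> : map sort_block block_rows = sorted_image.
  apply: (@eq_from_nth _ 0); rewrite size_map size_iota ?size_sorted_image //.
  move=> q ltq; rewrite (nth_map 0) ?size_iota // nth_iota // /sort_block.
  by rewrite ifT; [congr nth; lia | lia].
have outside l :
    {in l, forall q, ~~ (lo <= q < hi)} -> map sort_block l = map f l.
  by move=> out; apply/eq_in_map => q /out/negPf outq; rewrite /sort_block outq.
rewrite !outside; first by rewrite perm_cat2l perm_cat2r perm_sorted_image.
  by move=> q; rewrite mem_iota; lia.
by move=> q; rewrite mem_iota; lia.
Qed.

Lemma tracks_sort_block q : lo <= q < hi -> tracks sort_block m.+1 q.
Proof.
move=> inq; have ltq : q - lo < hi - lo by lia.
apply: tracksS => //; first exact: permutes_sort_block; first by lia.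
  rewrite /tracks /sort_block inq.
  have : nth 0 sorted_image (q - lo) \in image.
    by rewrite -(perm_mem perm_sorted_image) mem_nth ?size_sorted_image.
  case/mapP => p; rewrite mem_block => inp ->; rewrite tracks_f; last by lia.
  have /eqP <- := block_prefix_eq blk inp.
  by have /eqP <- := block_prefix_eq blk inq.
have /(congr1 (fun l => nth 0 l (q - lo))) := sorted_image_keys.
rewrite !(nth_map 0) ?size_sorted_image ?size_iota // nth_iota //.
rewrite subnKC; last by lia.
by rewrite /sort_block inq.
Qed.

Definition varies :=
  has (fun q => rot_entry (f q) m != rot_entry (f lo) m) block_rows.

Lemma constant_block_tracks q : ~~ varies -> lo <= q < hi -> tracks f m.+1 q.
Proof.
move/hasPn => const inq; apply: tracksS => //;
  try by [lia | apply: tracks_f; lia].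
have key_lo p : lo <= p < hi -> rot_entry (f p) m = rot_entry (f lo) m.
  by move=> inp; apply/eqP; rewrite -[_ == _]negbK const // mem_block.
have : entry q m \in [seq rot_entry (f p) m | p <- block_rows].
  by rewrite (perm_mem perm_block_keys) (map_f (entry^~ m)) ?mem_block.
by case/mapP => p; rewrite mem_block => inp ->; rewrite !key_lo.
Qed.

Lemma varying_block_splits : varies -> splits m lo < splits m hi.
Proof.
have [_ op_lo op_hi closed] := blk.
have [/hasP[j] | /hasPn no_split] :=
    boolP (has (fun j => ~~ opens m j && opens m.+1 j) block_rows).
  rewrite mem_block => inj /andP[cl_j op_j] _.
  exact: ltn_splits inj cl_j op_j.
have blkS : is_block m.+1 lo hi.
  split=> //; try by apply: opens_mono => //; lia.
  move=> j inj; have := no_split j; rewrite mem_block closed //; apply; lia.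
have entry_lo q : lo <= q < hi -> entry lo m = entry q m.
  by move=> inq; apply: prefix_eq_entry (block_prefix_eq blkS inq) _.
have key_lo q : lo <= q < hi -> rot_entry (f q) m = entry lo m.
  move=> inq; have : rot_entry (f q) m \in [seq entry p m | p <- block_rows].
    rewrite -(perm_mem perm_block_keys).
    by rewrite (map_f (fun p => rot_entry (f p) m)) ?mem_block.
  by case/mapP => p; rewrite mem_block => inp ->; rewrite -entry_lo.
by case/hasP => q; rewrite mem_block => inq; rewrite !key_lo ?eqxx //; lia.
Qed.

End Refinement.

Lemma varies_singleton f m lo : varies f m lo lo.+1 = false.
Proof. by rewrite /varies subSnn /= eqxx. Qed.

Lemma variesS f m lo h : lo <= h ->
  varies f m lo h.+1 =
  varies f m lo h || (rot_entry (f h) m != rot_entry (f lo) m).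
Proof.
move=> leh; rewrite /varies (_ : h.+1 - lo = (h - lo) + 1); last by lia.
by rewrite iotaD has_cat /= orbF subnKC.
Qed.

(* [refined_upto m x f]: the blocks of level m before row x have been sorted. *)
Definition refined_upto m x f :=
  permutes f /\ forall q, q < n -> tracks f (m + (q < x)) q.

Lemma refined_upto_id : refined_upto 0 0 id.
Proof.
by split=> [|q _]; rewrite /permutes ?map_id // /tracks addn0 !take0.
Qed.

Lemma refined_upto_tracks m x f q : refined_upto m x f -> q < n -> tracks f m q.
Proof.
case=> _ tracks_f ltq; have /(congr1 (take m)) := tracks_f q ltq.
by rewrite !take_takel ?leq_addr.
Qed.

Lemma eq_refined_upto m x f g :
  (forall q, q < n -> f q = g q) -> refined_upto m x f -> refined_upto m x g.
Proof.
move=> eq_fg [perm_f tracks_f]; split=> [|q ltq]; last first.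
  by rewrite /tracks -eq_fg //; apply: tracks_f.
rewrite /permutes (_ : map g _ = [seq f q | q <- iota 0 n]) //.
by apply/eq_in_map => q; rewrite mem_iota => ltq; rewrite eq_fg.
Qed.

Lemma refined_uptoS m f : refined_upto m n f -> refined_upto m.+1 0 f.
Proof.
case=> perm_f tracks_f; split=> // q ltq.
by have := tracks_f q ltq; rewrite ltq addn1 addn0.
Qed.

Lemma refined_upto_sort_block m lo hi f : m < n -> is_block m lo hi ->
  refined_upto m lo f -> refined_upto m hi (sort_block f m lo hi).
Proof.
move=> ltm blk ref; have [perm_f tracks_f] := ref; have [lohi _ _ _] := blk.
have tracks_m q : q < n -> tracks f m q by apply: refined_upto_tracks ref.
split=> [|q ltq]; first exact: permutes_sort_block.
have [inq|outq] := boolP (lo <= q < hi).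
  have -> : q < hi by lia.
  by rewrite addn1; apply: tracks_sort_block.
have -> : (q < hi) = (q < lo) by lia.
by rewrite /tracks /sort_block (negPf outq); apply: tracks_f.
Qed.

Lemma refined_upto_constant m lo hi f : m < n -> is_block m lo hi ->
  ~~ varies f m lo hi -> refined_upto m lo f -> refined_upto m hi f.
Proof.
move=> ltm blk const ref; have [perm_f tracks_f] := ref.
have [lohi _ _ _] := blk.
have tracks_m q : q < n -> tracks f m q by apply: refined_upto_tracks ref.
split=> // q ltq; have [inq|outq] := boolP (lo <= q < hi).
  have -> : q < hi by lia.
  by rewrite addn1; apply: constant_block_tracks inq.
by rewrite (_ : (q < hi) = (q < lo)); [apply: tracks_f | lia].
Qed.

End Matrix.

(** * A structured language and its compilation to the word RAM *)

Inductive variable : Type :=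
  | Len | Alphabet | Row | Level | Depth | Lo | Hi | Nth | Fill | Idx | Pos
  | Sym | Key | Mark | Branch.

(* Phi holds the permutation of the rows, Keys the column of the rotated rows to
   be sorted next, Marks the rows that open a block, and Context the symbols
   spelled out from a row. *)
Inductive array : Type := Context | Phi | Scratch | Keys | Marks.

(* The machine receives the length, the alphabet size and the row index in
   registers 0, 1 and 2. *)
Definition register (x : variable) : nat :=
  match x with
  | Len => 0 | Alphabet => 1 | Row => 2 | Level => 3 | Depth => 4 | Lo => 5
  | Hi => 6 | Nth => 7 | Fill => 8 | Idx => 9 | Pos => 10 | Sym => 11
  | Key => 12 | Mark => 13 | Branch => 14
  end.

Definition array_number (A : array) : nat :=
  match A with
  | Context => 0 | Phi => 1 | Scratch => 2 | Keys => 3 | Marks => 4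
  end.

Definition scratch : nat := 15.

(* The register that holds the address of the first cell of A. *)
Definition base (A : array) : nat := 16 + array_number A.

Lemma register_inj : injective register. Proof. by case; case. Qed.
Lemma array_number_inj : injective array_number. Proof. by case; case. Qed.

HB.instance Definition _ := Equality.copy variable (inj_type register_inj).
HB.instance Definition _ := Equality.copy array (inj_type array_number_inj).

Inductive expr : Type := Const of nat | Var of variable | Succ of variable.

Inductive basic : Type :=
  | Assign of variable & expr
  | Get of variable & array & variable
  | Put of array & variable & variable
  | GetLast of variable & variable
  | GetOrder of variable & variable & variable.

Inductive test : Type :=
  Lt of variable & variable | Eq of variable & variable | IsZero of variable.

Inductive command : Type :=
  | Do of seq basic
  | Then of command & command
  | If of test & command & command
  | While of test & command.

Local Notation "c ;; d" := (Then c d) (at level 60, right associativity).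
Local Notation Skip := (Do [::]).

Definition For x e y c :=
  Do [:: Assign x e] ;; While (Lt x y) (c ;; Do [:: Assign x (Succ x)]).

Definition code_basic (o : basic) : program :=
  match o with
  | Assign x (Const v) => [:: IConst (register x) v]
  | Assign x (Var y) =>
      [:: IConst scratch 0; IOp OAdd (register x) (register y) scratch]
  | Assign x (Succ y) =>
      [:: IConst scratch 1; IOp OAdd (register x) (register y) scratch]
  | Get x A j =>
      [:: IOp OAdd scratch (base A) (register j); ILoad (register x) scratch]
  | Put A j x =>
      [:: IOp OAdd scratch (base A) (register j); IStore scratch (register x)]
  | GetLast x j => [:: ILast (register x) (register j)]
  | GetOrder x l k =>
      [:: IOrder (register x) (base Context) (register l) (register k)]
  end.

(* Assumes that the scratch register holds 0. *)
Definition jump_if (b : test) (target : nat) : instr :=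
  match b with
  | Lt x y => IJumpLt (register x) (register y) target
  | Eq x y => IJumpEq (register x) (register y) target
  | IsZero x => IJumpEq (register x) scratch target
  end.

Fixpoint code (off : nat) (c : command) : program :=
  match c with
  | Do xs => flatten (map code_basic xs)
  | c1 ;; c2 => code off c1 ++ code (off + size (code off c1)) c2
  | If b c1 c2 =>
      let p2 := code off.+2 c2 in
      let off1 := (off.+2 + size p2).+1 in
      let p1 := code off1 c1 in
      IConst scratch 0 :: jump_if b off1 :: p2 ++ IJump (off1 + size p1) :: p1
  | While b c =>
      let p := code off.+3 c in
      IConst scratch 0 :: jump_if b off.+3 ::
      IJump (off.+3 + size p).+1 :: rcons p (IJump off)
  end.

Definition prologue : program :=
  [:: IConst scratch 1;
      IOp OAdd (base Phi) (register Len) scratch;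
      IOp OAdd (base Scratch) (base Phi) (base Phi);
      IOp OAdd (base Keys) (base Scratch) (base Phi);
      IOp OAdd (base Marks) (base Keys) (base Phi)].

Definition compile (c : command) : program :=
  prologue ++ code (size prologue) c ++ [:: IHalt].

Record state : Type := State {
  reg : variable -> nat;
  arr : array -> nat -> nat }.

Definition set_var st x v := State [eta reg st with x |-> v] (arr st).
Definition set_cell st A j v :=
  State (reg st) (fun B => if B == A then update (arr st A) j v else arr st B).

Definition eval st e :=
  match e with
  | Const v => v
  | Var x => reg st x
  | Succ x => (reg st x).+1
  end.

Definition holds st b :=
  match b with
  | Lt x y => reg st x < reg st y
  | Eq x y => reg st x == reg st y
  | IsZero x => reg st x == 0
  end.

Arguments set_var st x v /.
Arguments set_cell st A j v /.

(** ** Semantics *)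

Section Language.

Variables (w sigma : nat) (L : seq 'I_sigma).
Variable pi : seq 'I_sigma -> rel 'I_sigma.
Variable N : nat.

Definition context_cells st l := [seq arr st Context t | t <- iota 0 l].

Definition effect st (o : basic) : state :=
  match o with
  | Assign x e => set_var st x (eval st e)
  | Get x A j => set_var st x (arr st A (reg st j))
  | Put A j x => set_cell st A (reg st j) (reg st x)
  | GetLast x j => set_var st x (letter L (reg st j))
  | GetOrder x l k =>
      let y := pmap insub (context_cells st (reg st l)) in
      set_var st x (letter (listing (pi y)) (reg st k))
  end.

Definition safe st (o : basic) : bool :=
  match o with
  | Assign x e => eval st e < 2 ^ w
  | Get _ _ j | Put _ j _ => reg st j < N
  | GetLast _ j => reg st j < size L
  | GetOrder _ l k =>
      [&& reg st l <= N, all (gtn sigma) (context_cells st (reg st l))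
        & reg st k < sigma]
  end.

Definition cost st (o : basic) : nat :=
  if o is GetOrder _ l _ then (reg st l).+1 else 2.

Fixpoint safe_seq st xs :=
  if xs is o :: xs' then safe st o && safe_seq (effect st o) xs' else true.

Fixpoint cost_seq st xs :=
  if xs is o :: xs' then cost st o + cost_seq (effect st o) xs' else 0.

(* A test takes two steps and a jump takes one. *)
Inductive exec : command -> state -> nat -> state -> Prop :=
  | ExecDo xs st : safe_seq st xs ->
      exec (Do xs) st (cost_seq st xs) (foldl effect st xs)
  | ExecThen c1 c2 st1 t1 st2 t2 st3 :
      exec c1 st1 t1 st2 -> exec c2 st2 t2 st3 ->
      exec (c1 ;; c2) st1 (t1 + t2) st3
  | ExecIf b c1 c2 st t st' :
      exec (if holds st b then c1 else c2) st t st' ->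
      exec (If b c1 c2) st (t + 3) st'
  | ExecWhileEnd b c st : ~~ holds st b -> exec (While b c) st 3 st
  | ExecWhileLoop b c st1 t1 st2 t2 st3 :
      holds st1 b -> exec c st1 t1 st2 -> exec (While b c) st2 t2 st3 ->
      exec (While b c) st1 (t1 + 3 + t2) st3.

(** ** Correctness of the compilation *)

Definition reaches P t cf cf' :=
  (exists k, iter k (obind (step w L pi P)) (Some cf) = Some cf') /\
  time cf' <= time cf + t.

Lemma reaches_refl P cf : reaches P 0 cf cf.
Proof. by split; [exists 0 | rewrite addn0]. Qed.

Lemma reaches_trans P t1 t2 cf2 cf1 cf3 :
  reaches P t1 cf1 cf2 -> reaches P t2 cf2 cf3 -> reaches P (t1 + t2) cf1 cf3.
Proof.
move=> [[k run1] time1] [[l run2] time2]; split; last by lia.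
by exists (l + k); rewrite iterD run1.
Qed.

Definition represents off st cf :=
  [/\ pc cf = off,
      forall x, regs cf (register x) = reg st x,
      forall A, regs cf (base A) = array_number A * N,
      forall A j, j < N -> memory cf (array_number A * N + j) = arr st A j
    & space cf <= 5 * N].

Definition runs P t off st off' st' :=
  forall cf, represents off st cf ->
    exists2 cf', reaches P t cf cf' & represents off' st' cf'.

Lemma runs_refl P off st : runs P 0 off st off st.
Proof. by move=> cf rep; exists cf => //; apply: reaches_refl. Qed.

Lemma runs_trans P t1 t2 off2 st2 off1 st1 off3 st3 :
  runs P t1 off1 st1 off2 st2 -> runs P t2 off2 st2 off3 st3 ->
  runs P (t1 + t2) off1 st1 off3 st3.
Proof.
move=> run1 run2 cf1 /run1[cf2 r1 /run2[cf3 r2 rep]].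
by exists cf3 => //; apply: reaches_trans r1 r2.
Qed.

Lemma runs_leq P t1 t2 off st off' st' :
  t1 <= t2 -> runs P t1 off st off' st' -> runs P t2 off st off' st'.
Proof.
move=> le_t run cf /run[cf' [steps le_time] rep]; exists cf' => //; split=> //.
exact: leq_trans le_time (leq_add _ _).
Qed.

Lemma runs_step P t off st off' st' :
  (forall cf, represents off st cf ->
     exists cf', [/\ step w L pi P cf = Some cf', time cf' <= time cf + t
                   & represents off' st' cf']) ->
  runs P t off st off' st'.
Proof.
move=> one cf /one[cf' [step_cf le_t rep]].
by exists cf' => //; split=> //; exists 1.
Qed.

Definition placed (P : program) off (p : program) :=
  forall k, k < size p -> onth P (off + k) = onth p k.

Lemma placed_head P off x p : placed P off (x :: p) -> onth P off = Some x.
Proof. by move/(_ 0 isT); rewrite addn0. Qed.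

Lemma placed_behead P off x p : placed P off (x :: p) -> placed P off.+1 p.
Proof. by move=> pl k ltk; rewrite addSnnS pl. Qed.

Lemma placed_catl P off p q : placed P off (p ++ q) -> placed P off p.
Proof.
move=> pl k ltk; rewrite pl ?size_cat ?ltn_addr //.
by rewrite !onthE map_cat nth_cat size_map ltk.
Qed.

Lemma placed_catr P off p q :
  placed P off (p ++ q) -> placed P (off + size p) q.
Proof.
move=> pl k ltk; rewrite -addnA pl ?size_cat ?ltn_add2l //.
by rewrite !onthE map_cat nth_cat size_map ltnNge leq_addr addKn.
Qed.

Section Compilation.

Hypothesis arrays_fit : 5 * N <= 2 ^ w.

Lemma cell_lt A j : j < N -> array_number A * N + j < 5 * N.
Proof. by case: A => /=; lia. Qed.

Lemma represents_set_var off st cf x v t p :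
  p <= 5 * N -> represents off st cf ->
  represents off.+1 (set_var st x v)
    (Config (pc cf).+1 (update (regs cf) (register x) v) (memory cf) t p).
Proof.
move=> le_p [<- rep_reg rep_base rep_arr _]; split=> //= y.
  by rewrite /update (inj_eq register_inj) rep_reg.
by rewrite /update -rep_base; case: eqP => //; case: x; case: y.
Qed.

Lemma represents_set_scratch off st cf v :
  represents off st cf -> represents off.+1 st (set_reg cf scratch v).
Proof.
case=> <- rep_reg rep_base rep_arr le_sp; split=> //= y.
by rewrite /update -rep_reg; case: y.
Qed.

Lemma represents_set_cell off st cf A j v t p :
  j < N -> p <= 5 * N -> represents off st cf ->
  represents off.+1 (set_cell st A j v)
    (Config (pc cf).+1 (regs cf)
            (update (memory cf) (array_number A * N + j) v) t p).
Proof.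
move=> ltj le_p [<- rep_reg rep_base rep_arr _]; split=> //= B k ltk.
rewrite {1}/update; case: (eqVneq B A) => [->|neq_BA].
  by rewrite /update eqn_add2l rep_arr.
case: eqP => [/(congr1 (divn^~ N))|_]; last exact: rep_arr.
rewrite !divnMDl ?(leq_ltn_trans _ ltj) // !divn_small // !addn0.
by move/array_number_inj/eqP; rewrite (negPf neq_BA).
Qed.

Lemma represents_goto off off' st cf :
  represents off st cf -> represents off' st (goto cf off').
Proof. by case. Qed.

Lemma runs_jump P off st off' :
  onth P off = Some (IJump off') -> runs P 1 off st off' st.
Proof.
move=> at_off; apply: runs_step => cf rep; have [pc_off _ _ _ _] := rep.
exists (goto cf off'); rewrite /step pc_off at_off addn1.
by split=> //; apply: represents_goto rep.
Qed.

Lemma runs_scratch P v t off st off' st' :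
  (forall cf, represents off st cf ->
     step w L pi P cf = Some (set_reg cf scratch v)) ->
  (forall cf, represents off.+1 st cf -> regs cf scratch = v ->
     exists cf', [/\ step w L pi P cf = Some cf', time cf' <= time cf + t
                   & represents off' st' cf']) ->
  runs P t.+1 off st off' st'.
Proof.
move=> first_step second_step cf rep; have step1 := first_step _ rep.
have [|cf' [step2 le_t rep']] := second_step _ (represents_set_scratch v rep).
  by rewrite /= /update eqxx.
exists cf' => //; rewrite -add1n.
apply: (@reaches_trans _ _ _ (set_reg cf scratch v)).
  by split; [exists 1 | rewrite addn1].
by split; first by exists 1.
Qed.

Lemma runs_test P off st b off' p :
  placed P off (IConst scratch 0 :: jump_if b off' :: p) ->
  runs P 2 off st (if holds st b then off' else off.+2) st.
Proof.
move=> pl; have at0 := placed_head pl.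
have at1 := placed_head (placed_behead pl).
apply: (@runs_scratch _ 0) => cf rep; have [pc_off rep_reg _ _ _] := rep.
  by rewrite /step pc_off at0 mod0n.
move=> scratch0; exists (goto cf (if holds st b then off' else off.+2)).
rewrite /step pc_off at1 addn1; split=> //; last exact: represents_goto rep.
by case: b {pl at0 at1} => [x y|x y|x] /=; rewrite !rep_reg ?scratch0.
Qed.

Lemma step_address P off st cf A j :
  onth P off = Some (IOp OAdd scratch (base A) (register j)) -> reg st j < N ->
  represents off st cf ->
  step w L pi P cf = Some (set_reg cf scratch (array_number A * N + reg st j)).
Proof.
move=> at0 /(cell_lt A) lt_cell [pc_off rep_reg rep_base _ _].
rewrite /step pc_off at0 /= rep_base rep_reg modn_small //.
exact: leq_trans lt_cell arrays_fit.
Qed.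

Lemma runs_add_const P off st x y v :
  placed P off [:: IConst scratch v;
                   IOp OAdd (register x) (register y) scratch] ->
  reg st y + v < 2 ^ w ->
  runs P 2 off st off.+2 (set_var st x (reg st y + v)).
Proof.
move=> pl fits; have at0 := placed_head pl.
have at1 := placed_head (placed_behead pl).
apply: (@runs_scratch _ (v %% 2 ^ w)) => cf rep.
  by have [pc_off _ _ _ _] := rep; rewrite /step pc_off at0.
have [pc_off rep_reg _ _ le_sp] := rep => scratch_v.
exists (set_reg cf (register x) (reg st y + v)).
rewrite /step pc_off at1 /= rep_reg scratch_v modnDmr modn_small // addn1.
by split=> //; apply: represents_set_var le_sp rep.
Qed.

Lemma runs_assign P off st x e :
  placed P off (code_basic (Assign x e)) -> eval st e < 2 ^ w ->
  runs P 2 off st (off + size (code_basic (Assign x e)))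
       (set_var st x (eval st e)).
Proof.
case: e => [v|y|y] /= pl fits.
- rewrite addn1; apply: runs_step => cf rep; have [pc_off _ _ _ le_sp] := rep.
  exists (set_reg cf (register x) v).
  rewrite /step pc_off (placed_head pl) modn_small //.
  by split=> //=; [lia | apply: represents_set_var le_sp rep].
- by rewrite addn2; have := runs_add_const (st := st) pl; rewrite addn0; apply.
- by rewrite addn2; have := runs_add_const (st := st) pl; rewrite addn1; apply.
Qed.

Lemma runs_get P off st x A j :
  placed P off (code_basic (Get x A j)) -> reg st j < N ->
  runs P 2 off st off.+2 (set_var st x (arr st A (reg st j))).
Proof.
move=> pl ltj; have at1 := placed_head (placed_behead pl).
apply: runs_scratch => [cf rep|cf rep scratch_addr].
  exact: step_address (placed_head pl) ltj rep.
have [pc_off rep_reg _ rep_arr le_sp] := rep.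
rewrite /step pc_off at1 scratch_addr rep_arr //; eexists; split; first by [].
  by rewrite addn1.
rewrite -pc_off in rep *; apply: represents_set_var rep.
by rewrite geq_max le_sp cell_lt.
Qed.

Lemma runs_put P off st x A j :
  placed P off (code_basic (Put A j x)) -> reg st j < N ->
  runs P 2 off st off.+2 (set_cell st A (reg st j) (reg st x)).
Proof.
move=> pl ltj; have at1 := placed_head (placed_behead pl).
apply: runs_scratch => [cf rep|cf rep scratch_addr].
  exact: step_address (placed_head pl) ltj rep.
have [pc_off rep_reg _ _ le_sp] := rep.
rewrite /step pc_off at1 scratch_addr rep_reg; eexists; split; first by [].
  by rewrite addn1.
rewrite -pc_off in rep *; apply: represents_set_cell rep => //.
by rewrite geq_max le_sp cell_lt.
Qed.

Lemma runs_get_order P off st x l k :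
  placed P off (code_basic (GetOrder x l k)) -> safe st (GetOrder x l k) ->
  runs P (reg st l).+1 off st off.+1 (effect st (GetOrder x l k)).
Proof.
move=> /placed_head at0 /= /and3P[le_l small ltk].
apply: runs_step => cf rep; have [pc_off rep_reg rep_base rep_arr le_sp] := rep.
have cellsE :
    [seq memory cf t | t <- iota 0 (reg st l)] = context_cells st (reg st l).
  apply/eq_in_map => t; rewrite mem_iota => ltt.
  by have := rep_arr Context t; rewrite /= mul0n add0n; apply; lia.
rewrite /step pc_off at0 !rep_reg rep_base /= mul0n add0n.
rewrite (leq_trans le_l) /=; last by lia.
set y := pmap insub _.
have [|a at_k ->] := @onth_letter _ (listing (pi y)) (reg st k).
  by rewrite size_sort size_enum_ord.
rewrite /read_string cellsE small /= -/y at_k; eexists.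
split; [by [] | by [] |].
rewrite -pc_off in rep *; apply: represents_set_var rep.
by rewrite geq_max le_sp; lia.
Qed.

Lemma runs_get_last P off st x j :
  placed P off (code_basic (GetLast x j)) -> reg st j < size L ->
  runs P 2 off st off.+1 (effect st (GetLast x j)).
Proof.
move=> /placed_head at0 ltj; apply: runs_step => cf rep.
have [pc_off rep_reg _ _ le_sp] := rep; have [a at_j /= ->] := onth_letter ltj.
rewrite /step pc_off at0 rep_reg at_j /=; eexists.
split; [by [] | by rewrite addn2 /= |].
by rewrite -pc_off in rep *; apply: represents_set_var rep.
Qed.

Lemma runs_basic P off st o :
  placed P off (code_basic o) -> safe st o ->
  runs P (cost st o) off st (off + size (code_basic o)) (effect st o).
Proof.
case: o => [x e|x A j|A j x|x j|x l k] pl safe_o.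
- exact: runs_assign.
- by rewrite addn2; apply: runs_get.
- by rewrite addn2; apply: runs_put.
- by rewrite addn1; apply: runs_get_last.
- by rewrite addn1; apply: runs_get_order.
Qed.

Definition compiled c st t st' :=
  forall P off, placed P off (code off c) ->
    runs P t off st (off + size (code off c)) st'.

Lemma compiled_do st xs : safe_seq st xs ->
  compiled (Do xs) st (cost_seq st xs) (foldl effect st xs).
Proof.
move=> safe_xs P off /=; elim: xs st off safe_xs => [|o xs IH] st off /=.
  by rewrite addn0 => *; apply: runs_refl.
case/andP=> safe_o safe_xs pl; rewrite size_cat addnA.
apply: runs_trans (runs_basic (placed_catl pl) safe_o) _.
exact: IH safe_xs (placed_catr pl).
Qed.

Lemma compiled_then c1 c2 st1 t1 st2 t2 st3 :
  compiled c1 st1 t1 st2 -> compiled c2 st2 t2 st3 ->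
  compiled (c1 ;; c2) st1 (t1 + t2) st3.
Proof.
move=> run1 run2 P off pl; rewrite size_cat addnA.
exact: runs_trans (run1 _ _ (placed_catl pl)) (run2 _ _ (placed_catr pl)).
Qed.

Lemma compiled_if b c1 c2 st t st' :
  compiled (if holds st b then c1 else c2) st t st' ->
  compiled (If b c1 c2) st (t + 3) st'.
Proof.
move=> run P off /=; set p2 := code off.+2 c2.
set off1 := (off.+2 + size p2).+1.
set p1 := code off1 c1 => pl; have test := runs_test (st := st) pl.
have pl_branches := placed_behead (placed_behead pl).
have jump := runs_jump (st := st') (placed_head (placed_catr pl_branches)).
have pl1 := placed_behead (placed_catr pl_branches).
have -> : off + (size (p2 ++ IJump (off1 + size p1) :: p1)).+2 = off1 + size p1.
  by rewrite size_cat /= /off1; lia.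
case: holds run test => run test.
  by apply: runs_leq (runs_trans test (run _ _ pl1)); lia.
apply: (@runs_leq _ (2 + (t + 1))); first by lia.
exact: runs_trans test (runs_trans (run _ _ (placed_catl pl_branches)) jump).
Qed.

Lemma compiled_while_end b c st :
  ~~ holds st b -> compiled (While b c) st 3 st.
Proof.
move=> not_b P off /=; set p := code off.+3 c => pl.
have test := runs_test (st := st) pl; rewrite (negPf not_b) in test.
have -> : off + (size (rcons p (IJump off))).+3 = (off.+3 + size p).+1.
  by rewrite size_rcons; lia.
have at_jump := placed_head (placed_behead (placed_behead pl)).
exact: runs_trans test (runs_jump at_jump).
Qed.

Lemma compiled_while_loop b c st1 t1 st2 t2 st3 :
  holds st1 b -> compiled c st1 t1 st2 -> compiled (While b c) st2 t2 st3 ->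
  compiled (While b c) st1 (t1 + 3 + t2) st3.
Proof.
move=> b_holds body loop P off pl; apply: runs_trans (loop _ _ pl).
move: pl => /= pl; have := runs_test (st := st1) pl; rewrite b_holds => test.
have := placed_behead (placed_behead (placed_behead pl)).
rewrite -cats1 => pl_body.
apply: (@runs_leq _ (2 + (t1 + 1))); first by lia.
apply: runs_trans test (runs_trans (body _ _ (placed_catl pl_body)) _).
exact/runs_jump/placed_head/(placed_catr pl_body).
Qed.

Lemma exec_compiled c st t st' : exec c st t st' -> compiled c st t st'.
Proof.
elim=> {c st t st'}.
- by move=> xs st; apply: compiled_do.
- by move=> c1 c2 st1 t1 st2 t2 st3 _ run1 _; apply: compiled_then run1.
- by move=> b c1 c2 st t st' _; apply: compiled_if.
- by move=> b c st; apply: compiled_while_end.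
- move=> b c st1 t1 st2 t2 st3 b_holds _ body _.
  exact: compiled_while_loop b_holds body.
Qed.

Definition init_state i :=
  State (fun x => nth 0 [:: size L; sigma; i] (register x)) (fun _ _ => 0).

Hypothesis array_size : N = (size L).+1.

Lemma reaches_add P cf d a b v :
  onth P (pc cf) = Some (IOp OAdd d a b) ->
  regs cf a + regs cf b = v -> v < 2 ^ w ->
  reaches P 1 cf (set_reg cf d v).
Proof.
move=> at_pc def_v fits; split; last by rewrite addn1.
by exists 1; rewrite /= /step at_pc /= def_v modn_small.
Qed.

Lemma reaches_prologue P i : placed P 0 prologue ->
  exists2 cf, reaches P (size prologue) (init L i) cf
            & represents (size prologue) (init_state i) cf.
Proof.
move=> pl.
have at_k k : k < size prologue -> onth P k = onth prologue k.
  by move/pl; rewrite add0n.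
pose cf1 := set_reg (init L i) scratch 1.
pose cf2 := set_reg cf1 (base Phi) N.
pose cf3 := set_reg cf2 (base Scratch) (2 * N).
pose cf4 := set_reg cf3 (base Keys) (3 * N).
exists (set_reg cf4 (base Marks) (4 * N)); last first.
  by split=> //; case=> //; rewrite /= mul1n.
apply: (@reaches_trans _ 1 4 cf1).
  split; last by rewrite addn1.
  by exists 1; rewrite /= /step at_k //= modn_small //; lia.
apply: (@reaches_trans _ 1 3 cf2).
  by apply: reaches_add; [exact: at_k | rewrite /= array_size addn1 | lia].
apply: (@reaches_trans _ 1 2 cf3).
  by apply: reaches_add; [exact: at_k | rewrite /= addnn mul2n | lia].
apply: (@reaches_trans _ 1 1 cf4).
  by apply: reaches_add; [exact: at_k | rewrite /= /update /= -mulSnr | lia].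
by apply: reaches_add; [exact: at_k | rewrite /= /update /= -mulSnr | lia].
Qed.

(* The base address of Context is 0. *)
Lemma exec_halts c i st t :
  exec c (init_state i) t st ->
  exists cf,
    [/\ halts_with w L pi (compile c) i cf, time cf <= t + size prologue,
        space cf <= 5 * N & forall j, j < N -> memory cf j = arr st Context j].
Proof.
move=> run; set P := compile c.
have pl : placed P 0 P by [].
have [cf0 start rep0] := reaches_prologue i (placed_catl pl).
have pl_c := placed_catr pl.
have [cf body [pc_end _ _ rep_arr le_sp]] :=
  exec_compiled run (placed_catl pl_c) rep0.
have [steps le_t] := reaches_trans start body.
exists cf; split=> //; first last.
- by move=> j ltj; rewrite -(rep_arr Context).
- by apply: leq_trans le_t _; rewrite /= add0n addnC.
by split=> //; rewrite /halted pc_end; apply: placed_head (placed_catr pl_c).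
Qed.

End Compilation.

(** ** Weakest preconditions *)

Definition wp c (Q : state -> nat -> Prop) st :=
  exists st' t, exec c st t st' /\ Q st' t.

Lemma wp_do xs Q st :
  safe_seq st xs -> Q (foldl effect st xs) (cost_seq st xs) -> wp (Do xs) Q st.
Proof.
move=> safe_xs q; exists (foldl effect st xs), (cost_seq st xs).
by split=> //; apply: ExecDo.
Qed.

Lemma wp_then c1 c2 Q st :
  wp c1 (fun st1 t1 => wp c2 (fun st2 t2 => Q st2 (t1 + t2)) st1) st ->
  wp (c1 ;; c2) Q st.
Proof.
move=> [st1 [t1 [run1 [st2 [t2 [run2 q]]]]]]; exists st2, (t1 + t2).
by split=> //; apply: ExecThen run1 run2.
Qed.

Lemma wp_if b c1 c2 Q st :
  wp (if holds st b then c1 else c2) (fun st' t => Q st' (t + 3)) st ->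
  wp (If b c1 c2) Q st.
Proof.
move=> [st' [t [run q]]]; exists st', (t + 3).
by split=> //; apply: ExecIf.
Qed.

Definition assigned_basic o :=
  match o with
  | Assign x _ | Get x _ _ | GetLast x _ | GetOrder x _ _ => [:: x]
  | Put _ _ _ => [::]
  end.

Definition written_basic o := if o is Put A _ _ then [:: A] else [::].

Fixpoint assigned c : seq variable :=
  match c with
  | Do xs => flatten (map assigned_basic xs)
  | c1 ;; c2 | If _ c1 c2 => assigned c1 ++ assigned c2
  | While _ c => assigned c
  end.

Fixpoint written c : seq array :=
  match c with
  | Do xs => flatten (map written_basic xs)
  | c1 ;; c2 | If _ c1 c2 => written c1 ++ written c2
  | While _ c => written c
  end.

Definition frame c st st' :=
  (forall x, x \notin assigned c -> reg st' x = reg st x) /\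
  (forall A, A \notin written c -> arr st' A = arr st A).

Lemma frame_refl c st : frame c st st. Proof. by []. Qed.

Lemma frame_trans c st1 st2 st3 :
  frame c st1 st2 -> frame c st2 st3 -> frame c st1 st3.
Proof.
move=> [reg12 arr12] [reg23 arr23]; split=> [x x_c|A A_c].
  by rewrite reg23 ?reg12.
by rewrite arr23 ?arr12.
Qed.

Lemma frame_sub c c' st st' :
  {subset assigned c <= assigned c'} -> {subset written c <= written c'} ->
  frame c st st' -> frame c' st st'.
Proof.
move=> sub_assigned sub_written [reg_c arr_c]; split=> [x|A] out.
  by apply: reg_c; apply: contra out => /sub_assigned.
by apply: arr_c; apply: contra out => /sub_written.
Qed.

Lemma exec_frame c st t st' : exec c st t st' -> frame c st st'.
Proof.
elim=> {c st t st'} //=.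
- move=> xs st _; elim: xs st => // o xs IH st /=.
  have [reg_xs arr_xs] := IH (effect st o).
  split=> [y|A]; rewrite mem_cat negb_or => /andP[out out_xs].
    rewrite reg_xs //;
      case: o out {IH reg_xs arr_xs} => //= [z ?|z ? ?|z ?|z ? ?];
      by rewrite inE => /negPf->.
  rewrite arr_xs //; case: o out {IH reg_xs arr_xs} => //= B ? ?.
  by rewrite inE => /negPf->.
- move=> c1 c2 st1 t1 st2 t2 st3 _ fr1 _ fr2; apply: (@frame_trans _ _ st2).
    by apply: frame_sub fr1 => x x_c1; rewrite mem_cat x_c1.
  by apply: frame_sub fr2 => x x_c2; rewrite mem_cat x_c2 orbT.
- by move=> b c1 c2 st t st' _; case: holds; apply: frame_sub => x x_c;
    rewrite mem_cat x_c ?orbT.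
- by move=> b c st1 t1 st2 t2 st3 _ _ + _; apply: frame_trans.
Qed.

Lemma wp_conseq c (Q Q' : state -> nat -> Prop) st :
  wp c Q st ->
  (forall st' t, frame c st st' -> Q st' t -> Q' st' t) ->
  wp c Q' st.
Proof.
move=> [st' [t [run q]]] QQ'; exists st', t; split=> //.
exact: QQ' (exec_frame run) q.
Qed.

(* [k] is a ghost counter of the iterations and [pot k] bounds the time spent
   up to it. *)
Lemma wp_while b c (I : nat -> state -> Prop) pot bound Q k st :
  I k st ->
  (forall k st1, frame c st st1 -> I k st1 -> holds st1 b ->
     wp c (fun st2 t => exists k',
       [/\ k < k' <= bound, I k' st2 & t + pot k + 3 <= pot k']) st1) ->
  (forall k' st1 t, frame c st st1 -> I k' st1 -> ~~ holds st1 b ->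
     t + pot k <= pot k' + 3 -> Q st1 t) ->
  wp (While b c) Q st.
Proof.
move=> I_st body exit; have [d] := ubnP (bound.+1 - k).
elim: d => // d IH in k st Q I_st body exit *; rewrite ltnS => le_d.
have [b_holds|b_fails] := boolP (holds st b); last first.
  exists st, 3; split; first exact: ExecWhileEnd.
  by apply: exit I_st b_fails _; [apply: frame_refl | rewrite addnC].
have [st1 [t1 [run1 [k1 [/andP[ltk lek] I1 le_t1]]]]] :=
  body _ _ (frame_refl _ _) I_st b_holds.
have fr1 := exec_frame run1.
have fr st2 : frame c st1 st2 -> frame c st st2 by apply: frame_trans fr1.
have [||//|st2 [t2 [run2 q]]] := IH k1 st1 (fun st2 t => Q st2 (t1 + 3 + t)) I1.
- by move=> j st2 /fr; apply: body.
- by move=> j st2 t /fr fr2 I2 b_fails le_t; apply: exit fr2 I2 b_fails _; lia.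
- by lia.
exists st2, (t1 + 3 + t2); split=> //.
exact: ExecWhileLoop b_holds run1 run2.
Qed.

Lemma wp_for x e y c (I : nat -> state -> Prop) pot lo hi Q st :
  eval st e = lo -> reg st y = hi -> lo <= hi < 2 ^ w ->
  [&& x != y, x \notin assigned c & y \notin assigned c] ->
  I lo (set_var st x lo) ->
  (forall k st1, frame (For x e y c) st st1 -> reg st1 x = k -> lo <= k < hi ->
     I k st1 ->
     wp c (fun st2 t =>
       I k.+1 (set_var st2 x k.+1) /\ t + pot k + 5 <= pot k.+1) st1) ->
  (forall st1 t, frame (For x e y c) st st1 -> I hi st1 ->
     t + pot lo <= pot hi + 5 -> Q st1 t) ->
  wp (For x e y c) Q st.
Proof.
move=> eval_lo reg_hi /andP[lohi fits] /and3P[xy x_c y_c] I_lo body exit.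
apply: wp_then; apply: wp_do => /=; first by rewrite eval_lo; lia.
rewrite eval_lo; set st0 := State _ _.
have fr_for st1 : frame (c ;; Do [:: Assign x (Succ x)]) st0 st1 ->
    frame (For x e y c) st st1.
  case=> reg1 arr1; split=> [z z_for|A A_for]; last by rewrite arr1.
  rewrite reg1 /=; first by case: eqP z_for => // ->; rewrite inE eqxx.
  by move: z_for; rewrite inE negb_or => /andP[].
have reg_y st1 : frame (For x e y c) st st1 -> reg st1 y = hi.
  case=> -> //; rewrite /= inE mem_cat inE negb_or !negb_or eq_sym xy y_c //.
apply: (@wp_while _ _ (fun k st1 => [/\ I k st1, reg st1 x = k & lo <= k <= hi])
          pot hi _ lo).
- by rewrite /= eqxx leqnn.
- move=> k st1 /fr_for fr1 [I_k reg_x ink] /=.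
  rewrite (reg_y _ fr1) reg_x => ltk.
  have ink' : lo <= k < hi by lia.
  apply: wp_then; apply: wp_conseq (body _ _ fr1 reg_x ink' I_k) _.
  move=> st2 t [reg2 _] [I_kS le_t].
  have reg_x2 : reg st2 x = k by rewrite reg2.
  apply: wp_do => /=; first by rewrite reg_x2; lia.
  by exists k.+1; split; [lia | rewrite reg_x2 eqxx; split=> //; lia | lia].
- move=> k st1 t /fr_for fr1 [I_k reg_x ink] /=.
  rewrite (reg_y _ fr1) reg_x => gek le_t.
  have eq_k : k = hi by lia.
  by apply: exit; rewrite // -?eq_k //; lia.
Qed.

End Language.

(** * The inversion program *)

Definition extract :=
  For Idx (Const 0) Depth
    (Do [:: Get Pos Phi Pos; GetLast Sym Pos; Put Context Idx Sym]).

Definition scan_row :=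
  Do [:: Get Pos Phi Hi; Get Sym Keys Pos] ;;
  If (Eq Sym Key) Skip (Do [:: Assign Branch (Const 1)]) ;;
  Do [:: Assign Hi (Succ Hi); Get Mark Marks Hi].

Definition scan_block :=
  Do [:: Assign Hi (Succ Lo); Assign Branch (Const 0); Get Pos Phi Lo;
         Get Key Keys Pos; Get Mark Marks Hi] ;;
  While (IsZero Mark) scan_row.

Definition collect_bucket :=
  For Idx (Var Lo) Hi
    (Do [:: Get Pos Phi Idx; Get Sym Keys Pos] ;;
     If (Eq Sym Key)
       (Do [:: Put Scratch Fill Pos; Assign Fill (Succ Fill)])
       Skip).

Definition sort_rows :=
  Do [:: Assign Fill (Var Lo)] ;;
  For Nth (Const 0) Alphabet (Do [:: GetOrder Key Level Nth] ;; collect_bucket).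

Definition copy_rows :=
  For Idx (Var Lo) Hi (Do [:: Get Pos Scratch Idx; Put Phi Idx Pos]).

Definition refine_block :=
  Do [:: Assign Pos (Var Lo); Assign Depth (Var Level)] ;;
  extract ;; sort_rows ;; copy_rows.

Definition refine_level :=
  Do [:: Assign Lo (Const 0)] ;;
  While (Lt Lo Len)
    (scan_block ;; If (IsZero Branch) Skip refine_block ;;
     Do [:: Assign Lo (Var Hi)]).

Definition shift_keys :=
  For Idx (Const 0) Len
    (Do [:: Get Pos Phi Idx; Get Sym Keys Pos; Put Scratch Idx Sym]).

(* Key holds the symbol of the previous row; for row 0 it is stale, but the
   mark of row 0 is already set. *)
Definition mark_row :=
  Do [:: Get Sym Scratch Idx; Put Keys Idx Sym] ;;
  If (Eq Sym Key) Skip (Do [:: Put Marks Idx Mark]) ;;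
  Do [:: Assign Key (Var Sym)].

Definition mark_splits :=
  Do [:: Assign Mark (Const 1)] ;; For Idx (Const 0) Len mark_row.

Definition refine_levels :=
  For Level (Const 0) Len (refine_level ;; shift_keys ;; mark_splits).

Definition initialize :=
  For Idx (Const 0) Len
    (Do [:: Put Phi Idx Idx; GetLast Sym Idx; Put Keys Idx Sym]) ;;
  Do [:: Assign Pos (Const 0); Assign Mark (Const 1);
         Put Marks Pos Mark; Put Marks Len Mark].

Definition invert :=
  initialize ;; refine_levels ;;
  Do [:: Assign Pos (Var Row); Assign Depth (Var Len)] ;; extract.

Section Correctness.

Variables (w sigma n i : nat) (s : n.-tuple 'I_sigma).
Variable pi : seq 'I_sigma -> rel 'I_sigma.
Hypothesis tot_pi : forall x, is_total_order (pi x).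
Hypothesis arrays_fit : 5 * n.+1 <= 2 ^ w.
Hypothesis alphabet_fits : sigma < 2 ^ w.

Local Notation wp := (wp w (ca_bwt pi s) pi n.+1).
Local Notation entry := (entry s pi).
Local Notation rot_entry := (rot_entry s pi).
Local Notation opens := (opens s pi).
Local Notation is_block := (is_block s pi).
Local Notation varies := (varies s pi).
Local Notation refined_upto := (refined_upto s pi).

Definition params st :=
  [/\ reg st Len = n, reg st Alphabet = sigma & reg st Row = i].

Lemma frame_params c st st' :
  [&& Len \notin assigned c, Alphabet \notin assigned c
    & Row \notin assigned c] ->
  frame c st st' -> params st -> params st'.
Proof. by move=> /and3P[? ? ?] [reg_c _] [? ? ?]; split; rewrite reg_c. Qed.

Definition spells st m q := forall t, t < m -> arr st Context t = entry q t.

Lemma wp_extract m lo st :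
  reg st Depth = m -> m <= n -> reg st Pos < n ->
  refined_upto m lo (arr st Phi) ->
  wp extract (fun st' t => spells st' m (reg st Pos) /\ t <= 11 * m + 5) st.
Proof.
move=> depth lem ltp ref; set p := reg st Pos.
have phi_lt q : q < n -> arr st Phi q < n by apply: permutes_lt; case: ref.
have phi_entry q t : q < n -> t < m -> rot_entry (arr st Phi q) t = entry q t.
  by move=> ltq; apply: tracks_entry; apply: refined_upto_tracks ref ltq.
apply: (wp_for (lo := 0) (hi := m) (pot := muln 11) (I := fun j st1 =>
  [/\ reg st1 Pos < n,
      forall t, j + t < m -> entry (reg st1 Pos) t = entry p (j + t)
    & spells st1 j p])) => //.
- by lia.
- move=> j st1 [_ frA] idx inj [lt_pos follow filled] /=.
  have phi1 : arr st1 Phi = arr st Phi by rewrite frA.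
  have lt_phi := phi_lt _ lt_pos.
  apply: wp_do; rewrite /= phi1 idx ?size_ca_bwt; first by lia.
  rewrite letter_ca_bwt // phi_entry //; last by lia.
  split; last by lia.
  split=> // t ltt.
    by rewrite -rot_entryS ?phi_entry ?follow ?addSnnS //; lia.
  rewrite /= /update; case: eqVneq => [->|ne].
    by rewrite follow addn0; lia.
  by apply: filled; lia.
- by move=> st1 t _ [_ _ filled] le_t; split=> //; lia.
Qed.

Definition level m lo st :=
  [/\ refined_upto m lo (arr st Phi),
      m < n -> forall q, q < n -> arr st Keys q = rot_entry q m
    & forall t, t <= n -> arr st Marks t = opens m t].

Lemma level_phi_lt m lo st q : level m lo st -> q < n -> arr st Phi q < n.
Proof. by case=> -[perm_phi _] _ _; apply: permutes_lt. Qed.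

Lemma frame_level c m lo st st' :
  [&& Phi \notin written c, Keys \notin written c & Marks \notin written c] ->
  frame c st st' -> level m lo st -> level m lo st'.
Proof. by move=> /and3P[? ? ?] [_ arr_c] [? ? ?]; split; rewrite arr_c. Qed.

Definition scanned f m lo h st :=
  [/\ reg st Hi = h, reg st Key = rot_entry (f lo) m, reg st Mark = opens m h,
      reg st Branch = varies f m lo h
    & lo < h <= n /\ forall j, lo < j < h -> ~~ opens m j].

Lemma wp_scan_row m lo h st :
  m < n -> level m lo st -> scanned (arr st Phi) m lo h st -> ~~ opens m h ->
  wp scan_row (fun st' t => scanned (arr st Phi) m lo h.+1 st' /\ t <= 13) st.
Proof.
move=> ltm lv [hi key mark branch [inh closed]] h_closed.
have [_ /(_ ltm) keys marks] := lv.
have lth : h < n.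
  rewrite ltn_neqAle; case/andP: inh => _ ->; rewrite andbT.
  by apply: contra h_closed => /eqP->; apply: opens_end.
have phi_lt := level_phi_lt lv lth.
apply: wp_then; apply: wp_do; rewrite /= hi; first by lia.
rewrite keys //; apply: wp_then.
apply: (wp_conseq (Q := fun st1 t =>
    reg st1 Branch = varies (arr st Phi) m lo h.+1 /\ t <= 5)).
  apply: wp_if; rewrite /= key variesS; last by lia.
  by case: eqVneq => _; apply: wp_do; rewrite /= ?branch ?orbF ?orbT //; lia.
move=> st1 t [reg1 arr1] [branch1 le_t].
have hi1 : reg st1 Hi = h by rewrite reg1.
apply: wp_do; rewrite /= hi1; first by lia.
split; last by lia.
split=> //=; rewrite ?arr1 ?marks ?reg1 //.
split=> [|j inj]; first by lia.
by case: (ltnP j h) => [ltj|gej]; [apply: closed | rewrite (_ : j = h)]; lia.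
Qed.

Lemma wp_scan_block m lo st :
  m < n -> lo < n -> opens m lo -> reg st Lo = lo -> level m lo st ->
  wp scan_block (fun st' t =>
    [/\ is_block m lo (reg st' Hi),
        reg st' Branch = varies (arr st Phi) m lo (reg st' Hi)
      & t <= 16 * (reg st' Hi - lo) + 13]) st.
Proof.
move=> ltm ltlo op_lo st_lo lv; have [_ /(_ ltm) keys marks] := lv.
have phi_lt := level_phi_lt lv ltlo.
apply: wp_then; apply: wp_do; rewrite /= st_lo; first by lia.
rewrite keys // marks //.
apply: (wp_while (k := lo.+1) (bound := n) (pot := muln 16)
  (I := scanned (arr st Phi) m lo)).
- by split=> //=; [rewrite varies_singleton | split=> [|j]; lia].
- move=> h st1 fr1 scan1; have [_ arr1] := fr1.
  have [_ _ mark _ [inh _]] := scan1.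
  rewrite /= mark eqb0 => h_closed.
  have lv1 : level m lo st1 by apply: frame_level fr1 _.
  have phi1 : arr st1 Phi = arr st Phi by rewrite arr1.
  rewrite -phi1 in scan1.
  apply: wp_conseq (wp_scan_row ltm lv1 scan1 h_closed) _ => st2 t _.
  rewrite phi1 => -[scan2 le_t].
  by exists h.+1; split=> //; [have [_ _ _ _ [inS _]] := scan2 | ]; lia.
- move=> h st1 t _ [hi _ mark branch [inh closed]] /=.
  by rewrite mark eqb0 negbK hi => h_opens le_t; split=> //; lia.
Qed.

Definition image st lo hi := [seq arr st Phi j | j <- iota lo (hi - lo)].

Definition stored lo l st :=
  reg st Fill = lo + size l /\
  forall t, t < size l -> arr st Scratch (lo + t) = nth 0 l t.

Lemma stored_rcons lo l st st' q :
  stored lo l st -> reg st' Fill = (reg st Fill).+1 ->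
  arr st' Scratch = update (arr st Scratch) (reg st Fill) q ->
  stored lo (rcons l q) st'.
Proof.
move=> [fill old] fill' new; split=> [|t].
  by rewrite size_rcons fill' fill addnS.
rewrite size_rcons ltnS nth_rcons new fill /update eqn_add2l.
by case: (ltngtP t (size l)) => // ltt _; apply: old.
Qed.

Lemma wp_collect_bucket m lo hi a l st :
  lo < hi <= n -> (forall q, q < n -> arr st Phi q < n) ->
  (forall q, q < n -> arr st Keys q = rot_entry q m) ->
  reg st Lo = lo -> reg st Hi = hi -> reg st Key = a -> stored lo l st ->
  let l' := l ++ [seq q <- image st lo hi | rot_entry q m == a] in
  lo + size l' <= n ->
  wp collect_bucket (fun st' t =>
    stored lo l' st' /\ t <= 16 * (hi - lo) + 5) st.
Proof.
move=> lohi phi_lt keys st_lo st_hi key st_l l' room.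
pose part r := l ++ [seq q <- image st lo r | rot_entry q m == a].
have part_le r : r <= hi -> size (part r) <= size l'.
  move=> ler; rewrite !size_cat leq_add2l !size_filter.
  apply/leq_count_subseq/map_subseq.
  by rewrite -(minn_idPl (leq_sub2r lo ler)) -take_iota take_subseq.
apply: (wp_for (lo := lo) (hi := hi) (pot := muln 16)
               (I := fun r st1 => stored lo (part r) st1)) => //.
- lia.
- by rewrite /part /image subnn cats0; case: st_l => fill old; split.
- move=> r st1 [reg1 arr1] idx inr st_part.
  have phi_lt_r : arr st Phi r < n by apply: phi_lt; lia.
  apply: wp_then; apply: wp_do; rewrite /= idx arr1 //; first by lia.
  rewrite arr1 // keys //.
  have partS : part r.+1 = if rot_entry (arr st Phi r) m == a
                           then rcons (part r) (arr st Phi r) else part r.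
    rewrite /part /image (_ : r.+1 - lo = (r - lo) + 1); last by lia.
    rewrite iotaD map_cat filter_cat catA subnKC; last by lia.
    by rewrite /=; case: eqP; rewrite ?cats1 ?cats0.
  apply: wp_if => /=; rewrite reg1 // key partS.
  case: eqP => [eq_a|ne_a]; last first.
    by apply: wp_do => //=; split; [case: st_part | lia].
  have fill : reg st1 Fill < n.
    case: st_part => -> _; apply: leq_trans room; rewrite -addnS leq_add2l.
    by apply: leq_trans (part_le r.+1 _);
      [rewrite partS eq_a eqxx size_rcons | lia].
  apply: wp_do; rewrite /=; first by lia.
  by split; [apply: stored_rcons st_part _ _ | lia].
- by move=> st1 t _ st_l' le_t; split=> //; lia.
Qed.

Lemma context_cells_prefix m lo st :
  m <= n -> lo < n -> spells st m lo ->
  context_cells st m = map val (take m (row s pi lo)).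
Proof.
move=> lem ltlo spelled; have size_prefix : size (take m (row s pi lo)) = m.
  by rewrite size_take_min size_row //; lia.
apply: (@eq_from_nth _ 0); rewrite !size_map size_iota ?size_prefix // => x ltx.
by rewrite (nth_map 0) ?size_iota // nth_iota // spelled // map_take nth_take.
Qed.

Lemma wp_sort_rows m lo hi st :
  m < n -> is_block m lo hi -> level m lo st -> params st ->
  reg st Level = m -> reg st Lo = lo -> reg st Hi = hi ->
  spells st m lo ->
  wp sort_rows (fun st' t =>
    stored lo (sorted_image s pi (arr st Phi) m lo hi) st' /\
    t <= sigma * (m + 16 * (hi - lo) + 11) + 7) st.
Proof.
move=> ltm blk lv [_ alphabet _] level_m st_lo st_hi spelled.
have [[perm_phi _] keys _] := lv; have [lohi _ _ _] := blk.
have ltlo : lo < n by lia.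
have prefixE := context_cells_prefix (ltnW ltm) ltlo spelled.
pose codes := map val (listing (pi (take m (row s pi lo)))).
have size_codes : size codes = sigma.
  by rewrite size_map size_sort size_enum_ord.
pose sorted_upto k := buckets (rot_entry^~ m) (take k codes) (image st lo hi).
have sorted_all : sorted_upto sigma = sorted_image s pi (arr st Phi) m lo hi.
  by rewrite /sorted_upto take_oversize ?size_codes.
have sorted_le k : lo + size (sorted_upto k) <= n.
  suff : size (sorted_upto k) <= hi - lo by lia.
  by rewrite -(size_sorted_image perm_phi ltm blk) size_buckets_take.
apply: wp_then; apply: wp_do; rewrite /= st_lo; first by lia.
apply: (wp_for (lo := 0) (hi := sigma) (pot := muln (m + 16 * (hi - lo) + 11))
               (I := fun k st1 => stored lo (sorted_upto k) st1)) => //.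
- by rewrite /sorted_upto take0; split; rewrite ?addn0.
- move=> k st1 [reg1 arr1] nth_k ink st_k.
  have cells1 : context_cells st1 m = map val (take m (row s pi lo)).
    by rewrite -prefixE /context_cells arr1.
  apply: wp_then; apply: wp_do; rewrite /= nth_k reg1 //= level_m cells1.
    by rewrite all_map (eq_all (fun a => ltn_ord a)) all_predT; lia.
  rewrite (map_pK valK) -/codes; set a := nth 0 codes k.
  have sortedS : sorted_upto k.+1
      = sorted_upto k ++ [seq q <- image st lo hi | rot_entry q m == a].
    by rewrite -buckets_rcons /sorted_upto (take_nth 0) // size_codes; lia.
  have collect := @wp_collect_bucket m lo hi a (sorted_upto k) _ lohi.
  apply: wp_conseq (collect _ _ _ _ _ _ _ _) _;
    rewrite /image /= ?arr1 ?reg1 //.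
  + by move=> q; apply: level_phi_lt lv.
  + exact: keys.
  + by rewrite -/(image st lo hi) -sortedS.
  rewrite -/(image st lo hi) -sortedS => st2 t _ [[fill scratch] le_t].
  by split; [split | lia].
- by move=> st1 t _; rewrite sorted_all => st_k le_t; split=> //; lia.
Qed.

Lemma wp_copy_rows lo hi st :
  lo < hi <= n -> reg st Lo = lo -> reg st Hi = hi ->
  wp copy_rows (fun st' t =>
    (forall q,
       arr st' Phi q = arr st (if lo <= q < hi then Scratch else Phi) q) /\
    t <= 9 * (hi - lo) + 5) st.
Proof.
move=> lohi st_lo st_hi.
apply: (wp_for (lo := lo) (hi := hi) (pot := muln 9) (I := fun r st1 =>
  forall q,
    arr st1 Phi q = arr st (if lo <= q < r then Scratch else Phi) q)) => //.
- lia.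
- by move=> q; rewrite ltnNge andbN.
- move=> r st1 [_ arr1] idx inr copied.
  have scratch1 : arr st1 Scratch = arr st Scratch by rewrite arr1.
  apply: wp_do; rewrite /= idx ?scratch1; first by lia.
  split=> [q|]; last by lia.
  rewrite /update copied ltnS [q <= r]leq_eqVlt; case: eqVneq => // -> /=.
  by rewrite (_ : lo <= r) //; lia.
- by move=> st1 t _ copied le_t; split=> //; lia.
Qed.

Definition block_budget := 70 * (sigma * n).

Lemma wp_refine_block m lo hi st :
  m < n -> is_block m lo hi -> level m lo st -> params st ->
  reg st Level = m -> reg st Lo = lo -> reg st Hi = hi ->
  wp refine_block (fun st' t => level m hi st' /\ t <= block_budget) st.
Proof.
move=> ltm blk lv par level_m st_lo st_hi.
have [lohi _ _ _] := blk; have [ref keys marks] := lv; have [perm_phi _] := ref.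
apply: wp_then; apply: wp_do; rewrite /= st_lo level_m; first by lia.
apply: wp_then.
apply: wp_conseq (wp_extract (m := m) (lo := lo) _ _ _ _) _ => //=; try lia.
move=> st1 t1 [reg1 arr1] [spelled1 le_t1].
have lv1 : level m lo st1 by apply: frame_level (conj reg1 arr1) lv.
have par1 : params st1 by apply: frame_params (conj reg1 arr1) par.
apply: wp_then.
apply: wp_conseq (wp_sort_rows ltm blk lv1 par1 _ _ _ spelled1) _;
  rewrite ?reg1 //.
move=> st2 t2 [reg2 arr2] [[_ sorted2] le_t2].
apply: wp_conseq (wp_copy_rows lohi _ _) _; rewrite ?reg2 ?reg1 //.
move=> st3 t3 [_ arr3] [copied le_t3]; split.
  split=> [|_ q ltq|t let_]; try by rewrite arr3 ?arr2 ?arr1 ?keys ?marks.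
  apply: eq_refined_upto (refined_upto_sort_block tot_pi ltm blk ref) => q ltq.
  rewrite copied /sort_block; case: ifP => inq; last by rewrite arr2 ?arr1.
  have sz := size_sorted_image perm_phi ltm blk.
  rewrite -[in RHS](subnKC (proj1 (andP inq))) sorted2 ?arr1 // sz; lia.
have alphabet_pos : 0 < sigma by apply: alphabet_gt0 s _; lia.
have le_m : m + 16 * (hi - lo) + 11 <= 28 * n by lia.
have := leq_mul (leqnn sigma) le_m; have : n <= sigma * n by rewrite leq_pmull.
by rewrite /= /block_budget mulnCA; lia.
Qed.

Lemma wp_refine_if_varies m lo hi st :
  m < n -> is_block m lo hi -> level m lo st -> params st ->
  reg st Level = m -> reg st Lo = lo -> reg st Hi = hi ->
  reg st Branch = varies (arr st Phi) m lo hi ->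
  wp (If (IsZero Branch) Skip refine_block) (fun st' t => level m hi st' /\
    t + block_budget * splits s pi m lo
      <= block_budget * splits s pi m hi + 3) st.
Proof.
move=> ltm blk lv par level_m st_lo st_hi branch; have [ref keys marks] := lv.
apply: wp_if; rewrite /= branch;
  case: (boolP (varies _ _ _ _)) => [var|const] /=.
  have tracks_phi q : q < n -> tracks s pi (arr st Phi) m q.
    exact: refined_upto_tracks ref.
  have := varying_block_splits tot_pi (proj1 ref) tracks_phi ltm blk var.
  rewrite -addn1 => split_lt.
  apply: wp_conseq (wp_refine_block ltm blk lv par level_m st_lo st_hi) _.
  move=> st' t _ [lv' le_t].
  split=> //; have := leq_mul (leqnn block_budget) split_lt.
  by rewrite mulnDr; lia.
apply: wp_do => //=; split.
  by split=> //; apply: refined_upto_constant ltm blk const ref.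
have [/andP[lohi _] _ _ _] := blk.
by have := leq_mul (leqnn block_budget) (splits_leq s pi m (ltnW lohi)); lia.
Qed.

Lemma wp_refine_level m st :
  m < n -> level m 0 st -> params st -> reg st Level = m ->
  wp refine_level (fun st' t => level m n st' /\
    t <= 40 * n + block_budget * splits s pi m n + 5) st.
Proof.
move=> ltm lv par level_m.
apply: wp_then; apply: wp_do => /=; first by lia.
set st0 := State _ _.
apply: (wp_while (k := 0) (bound := n)
  (pot := fun lo => 40 * lo + block_budget * splits s pi m lo)
  (I := fun lo st1 =>
     [/\ reg st1 Lo = lo, lo <= n, opens m lo & level m lo st1])).
- by [].
- move=> lo st1 fr1 [st_lo lelo op_lo lv1] /=; have [reg1 _] := fr1.
  have par1 : params st1 by apply: frame_params fr1 _.
  have [len _ _] := par1; rewrite st_lo len => ltlo.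
  apply: wp_then; apply: wp_conseq (wp_scan_block ltm ltlo op_lo st_lo lv1) _.
  move=> st2 t2 fr2 [blk branch le_t2]; have [reg2 arr2] := fr2.
  set hi := reg st2 Hi in blk branch le_t2 *.
  have lv2 : level m lo st2 by apply: frame_level fr2 lv1.
  have par2 : params st2 by apply: frame_params fr2 par1.
  have [lohi _ op_hi _] := blk.
  apply: wp_then.
  apply: wp_conseq (wp_refine_if_varies ltm blk lv2 par2 _ _ _ _) _ => //.
  + by rewrite reg2 ?reg1.
  + by rewrite reg2.
  + by rewrite arr2.
  move=> st3 t3 [reg3 arr3] [lv3 le_t3].
  have hi3 : reg st3 Hi = hi by rewrite reg3.
  apply: wp_do; rewrite /= hi3; first by lia.
  exists hi; split=> //; [by split=> //; case/andP: lohi | lia].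
- move=> lo st1 t fr1 [st_lo lelo _ lv1]; have [reg1 _] := fr1.
  have [len _ _] : params st1 by apply: frame_params fr1 _.
  rewrite /= st_lo len => gelo le_t; have eq_lo : lo = n by lia.
  by rewrite eq_lo in lv1 le_t; split=> //; lia.
Qed.

Definition column st A m r := forall q, q < r -> arr st A q = entry q m.

Lemma wp_shift_keys m st :
  m < n -> level m n st -> params st ->
  wp shift_keys (fun st' t => column st' Scratch m n /\ t <= 11 * n + 5) st.
Proof.
move=> ltm lv [len _ _]; have [[_ tracks_phi] keys _] := lv.
apply: (wp_for (lo := 0) (hi := n) (pot := muln 11)
  (I := fun r st1 => column st1 Scratch m r)) => //; first by lia.
- move=> r st1 [_ arr1] idx ltr shifted.
  have phi1 : arr st1 Phi = arr st Phi by rewrite arr1.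
  have keys1 : arr st1 Keys = arr st Keys by rewrite arr1.
  have phi_lt := level_phi_lt lv ltr.
  have key_r : rot_entry (arr st Phi r) m = entry r m.
    by apply: tracks_entry (tracks_phi r _) _; lia.
  apply: wp_do; rewrite /= idx ?phi1 ?keys1; first by lia.
  split=> [q|]; last by lia.
  rewrite ltnS leq_eqVlt /= /update keys // key_r.
  by case: eqVneq => [->|_] //= ltq; apply: shifted.
- by move=> st1 t _ shifted le_t; split=> //; lia.
Qed.

Definition marked m r st :=
  [/\ column st Keys m r, 0 < r -> reg st Key = entry r.-1 m
    & forall u, u <= n -> arr st Marks u = opens (m + (u < r)) u].

Lemma wp_mark_row m r st :
  m < n -> r < n -> reg st Idx = r -> reg st Mark = 1 ->
  column st Scratch m n -> marked m r st ->
  wp mark_row (fun st' t => marked m r.+1 st' /\ t <= 11) st.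
Proof.
move=> ltm ltr idx mark shifted [keys key marks].
apply: wp_then; apply: wp_do; rewrite /= idx; first by lia.
rewrite shifted //; apply: wp_then.
apply: (wp_conseq (Q := fun st1 t => (forall u, u <= n ->
    arr st1 Marks u = opens (m + (u < r.+1)) u) /\ t <= 5)).
  have old_mark u :
      u <= n -> u != r -> arr st Marks u = opens (m + (u < r.+1)) u.
    by move=> leu ne_u; rewrite ltnS [u <= r]leq_eqVlt (negPf ne_u) marks.
  have opens_r : opens m.+1 r = opens m r || (reg st Key != entry r m).
    by have [->|r_gt0] := posnP r; rewrite // opensS ?key //; lia.
  apply: wp_if => /=; case: eqP => [eq_key|/eqP ne_key]; apply: wp_do;
    rewrite //= ?idx; try lia; split=> // u leu.
    case: (eqVneq u r) => [->|]; last exact: old_mark.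
    rewrite marks; last by lia.
    by rewrite ltnn ltnSn addn0 addn1 opens_r eq_key eqxx orbF.
  rewrite /update; case: eqVneq => [->|]; last exact: old_mark.
  by rewrite ltnSn addn1 opens_r eq_sym ne_key orbT.
move=> st1 t [reg1 arr1] [marks1 le_t].
have sym1 : reg st1 Sym = entry r m by rewrite reg1.
apply: wp_do; rewrite /= sym1;
  first by rewrite (ltn_trans (entry_lt _ _ _ _)) //; lia.
split; last by lia.
split=> // q; rewrite arr1 //= /update ltnS leq_eqVlt.
by case: eqVneq => [->|_] //= ltq; apply: keys.
Qed.

Lemma wp_mark_splits m st :
  m < n -> params st -> column st Scratch m n ->
  (forall t, t <= n -> arr st Marks t = opens m t) ->
  wp mark_splits (fun st' t =>
    [/\ column st' Keys m n,
        forall u, u <= n -> arr st' Marks u = opens m.+1 u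
      & t <= 16 * n + 7]) st.
Proof.
move=> ltm [len _ _] shifted marks.
apply: wp_then; apply: wp_do => /=; first by lia.
apply: (wp_for (lo := 0) (hi := n) (pot := muln 16) (I := marked m)) => //.
- by lia.
- by split=> // u leu; rewrite addn0 marks.
- move=> r st1 [reg1 arr1] idx ltr marked1.
  have mark1 : reg st1 Mark = 1 by rewrite reg1.
  have shifted1 : column st1 Scratch m n by rewrite /column arr1.
  apply: wp_conseq (wp_mark_row ltm ltr idx mark1 shifted1 marked1) _.
  by move=> st2 t _ [marked2 le_t]; split; [case: marked2 | lia].
- move=> st1 t _ [keys1 _ marks1] le_t; split=> // [u leu|]; last by lia.
  rewrite marks1 //; case: ltnP => [_|gen]; first by rewrite addn1.
  by have -> : u = n by [lia]; rewrite !opens_end.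
Qed.

Definition levels_budget m := 100 * n * m + block_budget * opened s pi m n.

Lemma wp_next_level m st :
  m < n -> level m 0 st -> params st -> reg st Level = m ->
  wp (refine_level ;; shift_keys ;; mark_splits) (fun st' t =>
    level m.+1 0 st' /\ t + levels_budget m + 5 <= levels_budget m.+1) st.
Proof.
move=> ltm lv par level_m.
apply: wp_then; apply: wp_conseq (wp_refine_level ltm lv par level_m) _.
move=> st1 t1 fr1 [lv1 le_t1].
have par1 : params st1 by apply: frame_params fr1 par.
apply: wp_then; apply: wp_conseq (wp_shift_keys ltm lv1 par1) _.
move=> st2 t2 fr2 [shifted le_t2].
have par2 : params st2 by apply: frame_params fr2 par1.
have [ref2 _ marks2] : level m n st2 by apply: frame_level fr2 lv1.
apply: wp_conseq (wp_mark_splits ltm par2 shifted marks2) _.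
move=> st3 t3 [_ arr3] [keys3 marks3 le_t3]; split.
  split=> // [|ltm1 q ltq]; first by rewrite arr3 //; apply: refined_uptoS.
  by rewrite rot_entryS // keys3.
by rewrite /levels_budget openedS // mulnS mulnDr; lia.
Qed.

Lemma wp_refine_levels st :
  level 0 0 st -> params st ->
  wp refine_levels (fun st' t =>
    level n 0 st' /\ t <= 100 * n * n + block_budget * n + 5) st.
Proof.
move=> lv [len alphabet row_i].
apply: (wp_for (lo := 0) (hi := n) (pot := levels_budget)
               (I := fun m st1 => level m 0 st1)) => //; first by lia.
- move=> m st1 fr1 level_m ltm lv1.
  apply: wp_conseq (wp_next_level ltm lv1 _ level_m) _ => //.
  by case: fr1 => reg1 _; split; rewrite reg1.
- move=> st1 t _ lv1 le_t; split=> //.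
  have := leq_mul (leqnn block_budget) (opened_le s pi n n).
  by move: le_t; rewrite /levels_budget; lia.
Qed.

Lemma wp_initialize st :
  0 < n -> params st -> (forall u, arr st Marks u = 0) ->
  wp initialize (fun st' t => level 0 0 st' /\ t <= 11 * n + 13) st.
Proof.
move=> n_gt0 [len _ _] marks.
apply: wp_then.
apply: (wp_for (lo := 0) (hi := n) (pot := muln 11) (I := fun r st1 =>
  forall q, q < r -> arr st1 Phi q = q /\ arr st1 Keys q = rot_entry q 0))
  => //.
- by lia.
- move=> r st1 _ idx /= ltr filled.
  apply: wp_do; rewrite /= idx ?size_ca_bwt; first by lia.
  rewrite letter_ca_bwt //; split=> [q|]; last by lia.
  rewrite ltnS leq_eqVlt /update; case: eqVneq => [->|_] //= ltq.
  exact: filled.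
move=> st1 t [reg1 arr1] filled le_t.
apply: wp_do; rewrite /= reg1 //= len; first by lia.
split; last by lia.
split=> /=.
- apply: (eq_refined_upto (f := id)) => [q /filled[->]|] //.
  exact: refined_upto_id.
- by move=> _ q /filled[].
- move=> u leu; rewrite /= /update opens0 arr1 // marks.
  by case: eqVneq => [->|]; rewrite ?orbT // orbF; case: eqVneq.
Qed.

Lemma wp_invert st :
  i < n -> params st -> (forall u, arr st Marks u = 0) ->
  wp invert (fun st' t =>
    (forall x, x < n -> arr st' Context x = entry i x) /\
    t <= 250 * (sigma * n ^ 2)) st.
Proof.
move=> lti par marks; have n_gt0 : 0 < n by apply: leq_ltn_trans lti.
apply: wp_then; apply: wp_conseq (wp_initialize n_gt0 par marks) _.
move=> st1 t1 fr1 [lv1 le_t1].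
have par1 : params st1 by apply: frame_params fr1 par.
apply: wp_then; apply: wp_conseq (wp_refine_levels lv1 par1) _.
move=> st2 t2 fr2 [[ref2 _ _] le_t2].
have [len alphabet row_i] : params st2.
  by case: fr2 => reg2 _; case: par1; split; rewrite reg2.
apply: wp_then; apply: wp_do; rewrite /= len row_i; first by lia.
apply: wp_conseq (wp_extract (m := n) (lo := 0) _ _ _ _) _ => //=.
move=> st3 t3 _ [output le_t3]; split=> //.
have le_n : n <= sigma * n by rewrite leq_pmull ?(alphabet_gt0 s).
have := leq_mul le_n (leqnn n); have := leq_mul (leqnn (sigma * n)) n_gt0.
by rewrite -mulnn mulnA muln1 /block_budget in le_t2 *; lia.
Qed.

Lemma compile_invert_spec : i < n ->
  exists cf,
    [/\ halts_with w (ca_bwt pi s) pi (compile invert) i cf,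
        time cf <= 250 * (sigma * n ^ 2) + 5, space cf <= 5 * n.+1
      & [seq memory cf j | j <- iota 0 n] = map val (row s pi i)].
Proof.
move=> lti; pose st0 := init_state (ca_bwt pi s) i.
have params0 : params st0 by split; rewrite //= size_ca_bwt.
have [//|st [t [run [spelled le_t]]]] := wp_invert lti params0.
have [|cf [halts le_time le_space cells]] := exec_halts arrays_fit _ run.
  by rewrite size_ca_bwt.
exists cf; split=> //; first by rewrite (leq_trans le_time) // leq_add2r.
apply: (@eq_from_nth _ 0); rewrite !size_map size_iota ?size_row // => x ltx.
by rewrite (nth_map 0) ?size_iota // nth_iota // cells ?spelled //; lia.
Qed.

End Correctness.

Theorem theorem11 (k : nat) :
  exists (P : program) (C : nat),
    forall (w sigma n : nat) (s : n.-tuple 'I_sigma)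
           (pi : seq 'I_sigma -> rel 'I_sigma) (i : nat),
      sigma <= w ^ k ->
      C * sigma * n < 2 ^ w ->
      primitive s ->
      (forall x : seq 'I_sigma, is_total_order (pi x)) ->
      i < n ->
      nth [::] (ca_matrix pi s) i = s ->
      exists c : config,
        [/\ halts_with w (ca_bwt pi s) pi P i c,
            time c <= C * (sigma * n ^ 2),
            space c <= C * (sigma * n) &
            [seq memory c j | j <- iota 0 n] = [seq val a | a <- s]].
Proof.
exists (compile invert), 300 => w sigma n s pi i _ fits _ tot_pi lti row_i.
have n_gt0 : 0 < n by apply: leq_ltn_trans lti.
have sigma_gt0 := alphabet_gt0 s n_gt0.
have le_n : n <= sigma * n by rewrite leq_pmull.
have le_sigma : sigma <= sigma * n by rewrite leq_pmulr.
have le_n2 : sigma * n <= sigma * n ^ 2.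
  by rewrite leq_mul2l -mulnn leq_pmulr ?orbT.
rewrite -mulnA in fits.
have arrays_fit : 5 * n.+1 <= 2 ^ w by lia.
have alphabet_fits : sigma < 2 ^ w by lia.
have [cf [halts le_time le_space output]] :=
  compile_invert_spec s tot_pi arrays_fit alphabet_fits lti.
exists cf; split; [exact: halts | lia | lia |].
by rewrite output /row row_i.
Qed.
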